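(* Let $\varGamma$ be an oriented modular graph and $g:\varGamma\to\mathbf{R}\cup\{\infty\}$ an L-convex function, and assume that $\varGamma$ is locally finite or the image of $g$ is discrete (there is $\epsilon>0$ such that $[g(x)-\epsilon,g(x)+\epsilon]\cap g(\varGamma)=\{g(x)\}$ for every $x\in\varGamma$). Then a vertex $x\in\operatorname{dom}g$ is a minimizer of $g$ over $\varGamma$ if and only if $x$ is a minimizer of $g$ over $\mathcal{F}'_x\cup\mathcal{I}'_x$.
   Context: All graphs are connected, simple, undirected, possibly infinite; $d$ is the shortest-path metric, $I(x,y)=\{z:d(x,z)+d(z,y)=d(x,y)\}$. A graph is modular if $I(x,y)\cap I(y,z)\cap I(z,x)\ne\emptyset$ for all $x,y,z$. An orientation is admissible if for every 4-cycle $(x_1,x_2,x_3,x_4)$, $x_1\to x_2$ implies $x_4\to x_3$. An oriented modular graph is a modular graph with an admissible orientation; $p\preceq q$ means there is a directed path from $q$ to $p$. For $p\preceq q$, $[p,q]$ is a modular lattice; $p\sqsubseteq q$ means $p\preceq q$ and $[p,q]$ is a complemented modular lattice (every element a join of elements covering $p$). $\mathcal{F}'_x=\{y:x\sqsubseteq y\}$, $\mathcal{I}'_x=\{y:y\sqsubseteq x\}$. $\operatorname{dom}g=\{x:g(x)<\infty\}$. A $\varDelta'$-path is $x_0,\dots,x_m$ with $x_i\sqsubseteq x_{i+1}$ or $x_{i+1}\sqsubseteq x_i$; a set is $\varDelta'$-connected if any two distinct members are joined by a $\varDelta'$-path inside it. $\varGamma^*$ is the set of intervals $[x,y]$ with $x\sqsubseteq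 y$; $\mathcal{I}^*_x$ is the set of $[y,z]\in\varGamma^*$ with $y\preceq x\preceq z$ ordered by inclusion (a modular semilattice). $g^*([x,y])=(g(x)+g(y))/2$. $g$ is L-convex if $\operatorname{dom}g$ is $\varDelta'$-connected and for every vertex $x$ the restriction of $g^*$ to $\mathcal{I}^*_x$ is submodular. Submodularity on a modular semilattice $\mathcal{L}$ (meet-semilattice of finite rank, rank $r$, principal ideals modular lattices, $x\vee y\vee z$ exists when pairwise joins exist): $I(p,q)$ = elements on shortest $p$–$q$ paths of the covering graph; $r(u;p,q)=(r(u\wedge p)-r(p\wedge q),r(u\wedge q)-r(p\wedge q))$; $\mathcal{E}(p,q)$ = the $u\in I(p,q)$ with $r(u;p,q)$ a componentwise-maximal extreme point of the convex hull $\mathrm{Conv}I(p,q)$; $C(u;p,q)=\{w\in\mathbf{R}^2_{\ge0}:\langle w,r(u;p,q)\rangle=\max_{z\in\mathrm{Conv}I(p,q)}\langle w,z\rangle\}=\{(x,y)\ge0:y\cos\alpha\le x\sin\alpha,\ y\cos\beta\ge x\sin\beta\}$ ($0\le\beta\le\alpha\le\pi/2$), $[C]=\frac{\sin\alpha}{\sin\alpha+\cos\alpha}-\frac{\sin\beta}{\sin\beta+\cos\beta}$. $f$ is submodular if $f(p)+f(q)\ge f(p\wedge q)+\sum_{u\in\mathcal{E}(p,q)}[C(u;p,q)]f(u)$ for all $p,q$ (zero-coefficient terms omitted; $a+\infty=\infty$). *)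

(* Defs.v *)
From Stdlib Require Import Reals List Relations Classical ClassicalEpsilon.
Open Scope R_scope.

Inductive ER : Type := Fin (r : R) | PInf.

Definition ER_add (a b : ER) : ER :=
  match a, b with Fin x, Fin y => Fin (x + y) | _, _ => PInf end.
(* scaling by a (nonzero, in practice positive) real; c * ∞ = ∞ *)
Definition ER_scale (c : R) (a : ER) : ER :=
  match a with Fin x => Fin (c * x) | PInf => PInf end.
Definition ER_le (a b : ER) : Prop :=
  match a, b with
  | _, PInf => True
  | Fin x, Fin y => x <= y
  | PInf, Fin _ => False
  end.

Definition in_dom {V : Type} (g : V -> ER) (x : V) : Prop := exists r, g x = Fin r.

Inductive walk {T : Type} (adj : T -> T -> Prop) : T -> T -> nat -> Prop :=
| walk_nil : forall x, walk adj x x 0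
| walk_cons : forall x z y n, adj x z -> walk adj z y n -> walk adj x y (S n).

Definition is_dist {T : Type} (adj : T -> T -> Prop) (x y : T) (n : nat) : Prop :=
  walk adj x y n /\ forall m, walk adj x y m -> (n <= m)%nat.

(* shortest-path distance d(x,y) (well defined on connected graphs) *)
Definition gdist {T : Type} (adj : T -> T -> Prop) (x y : T) : nat :=
  epsilon (inhabits 0%nat) (is_dist adj x y).

Definition ginterval {T : Type} (adj : T -> T -> Prop) (x y z : T) : Prop :=
  (gdist adj x z + gdist adj z y)%nat = gdist adj x y.

Definition simple_connected_graph {V : Type} (adj : V -> V -> Prop) : Prop :=
  (forall x y, adj x y -> adj y x) /\
  (forall x, ~ adj x x) /\
  (forall x y, exists n, walk adj x y n).

Definition modular_graph {V : Type} (adj : V -> V -> Prop) : Prop :=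
  forall x y z, exists w,
    ginterval adj x y w /\ ginterval adj y z w /\ ginterval adj z x w.

Definition locally_finite {V : Type} (adj : V -> V -> Prop) : Prop :=
  forall x, exists l : list V, forall y, adj x y -> In y l.

Definition orientation {V : Type} (adj arc : V -> V -> Prop) : Prop :=
  (forall x y, arc x y -> adj x y) /\
  (forall x y, adj x y -> arc x y \/ arc y x) /\
  (forall x y, ~ (arc x y /\ arc y x)).

Definition four_cycle {V : Type} (adj : V -> V -> Prop) (x1 x2 x3 x4 : V) : Prop :=
  adj x1 x2 /\ adj x2 x3 /\ adj x3 x4 /\ adj x4 x1 /\ x1 <> x3 /\ x2 <> x4.

Definition admissible_orientation {V : Type} (adj arc : V -> V -> Prop) : Prop :=
  orientation adj arc /\
  forall x1 x2 x3 x4, four_cycle adj x1 x2 x3 x4 -> arc x1 x2 -> arc x4 x3.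

Definition preceq {V : Type} (arc : V -> V -> Prop) (p q : V) : Prop :=
  clos_refl_trans V arc q p.

Definition covers_pre {V : Type} (arc : V -> V -> Prop) (p a : V) : Prop :=
  preceq arc p a /\ p <> a /\
  forall z, preceq arc p z -> preceq arc z a -> z = p \/ z = a.

Definition join_in {V : Type} (arc : V -> V -> Prop) (p q : V) (l : list V) (z : V) : Prop :=
  preceq arc p z /\ preceq arc z q /\
  (forall a, In a l -> preceq arc a z) /\
  (forall w, preceq arc p w -> preceq arc w q ->
     (forall a, In a l -> preceq arc a w) -> preceq arc z w).

(* p ⊑ q : p ⪯ q and [p,q] is complemented (every element is a join of
   elements covering p) *)
Definition sqsub {V : Type} (arc : V -> V -> Prop) (p q : V) : Prop :=
  preceq arc p q /\
  forall z, preceq arc p z -> preceq arc z q ->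
    exists l : list V, (forall a, In a l -> covers_pre arc p a) /\ join_in arc p q l z.

Section Semilattice.
Variables (T : Type) (P : T -> Prop) (le : T -> T -> Prop).

Definition smeet (p q : T) : T :=
  epsilon (inhabits p) (fun m => P m /\ le m p /\ le m q /\
    forall z, P z -> le z p -> le z q -> le z m).

Definition scovers (a b : T) : Prop :=
  P a /\ P b /\ le a b /\ a <> b /\
  forall z, P z -> le a z -> le z b -> z = a \/ z = b.

Definition cov_adj (a b : T) : Prop := scovers a b \/ scovers b a.

Inductive cov_chain : T -> T -> nat -> Prop :=
| cc_nil : forall a, cov_chain a a 0
| cc_cons : forall a b c n, scovers a b -> cov_chain b c n -> cov_chain a c (S n).

Definition sbottom (u : T) : T :=
  epsilon (inhabits u) (fun b => P b /\ forall z, P z -> le b z).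

Definition srank (u : T) : nat :=
  epsilon (inhabits 0%nat) (fun n => cov_chain (sbottom u) u n).

Definition rvec (p q u : T) : R * R :=
  (INR (srank (smeet u p)) - INR (srank (smeet p q)),
   INR (srank (smeet u q)) - INR (srank (smeet p q))).

Definition Icov (p q u : T) : Prop := P u /\ ginterval cov_adj p q u.

Definition rpoints (p q : T) (z : R * R) : Prop :=
  exists u, Icov p q u /\ z = rvec p q u.

End Semilattice.

Definition conv (S : R * R -> Prop) (z : R * R) : Prop :=
  exists l : list (R * (R * R)),
    l <> nil /\
    (forall w x, In (w, x) l -> 0 <= w /\ S x) /\
    fold_right (fun wx acc => fst wx + acc) 0 l = 1 /\
    z = (fold_right (fun wx acc => fst wx * fst (snd wx) + acc) 0 l,
         fold_right (fun wx acc => fst wx * snd (snd wx) + acc) 0 l).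

Definition extreme_point (K : R * R -> Prop) (z : R * R) : Prop :=
  K z /\ forall a b t, K a -> K b -> 0 < t < 1 ->
    z = (t * fst a + (1 - t) * fst b, t * snd a + (1 - t) * snd b) -> a = b.

Definition comp_maximal (K : R * R -> Prop) (z : R * R) : Prop :=
  K z /\ forall z', K z' -> fst z <= fst z' -> snd z <= snd z' -> z' = z.

Definition dot (w z : R * R) : R := fst w * fst z + snd w * snd z.

Section Submod.
Variables (T : Type) (P : T -> Prop) (le : T -> T -> Prop).

Definition Eset (p q u : T) : Prop :=
  Icov T P le p q u /\
  extreme_point (conv (rpoints T P le p q)) (rvec T P le p q u) /\
  comp_maximal (conv (rpoints T P le p q)) (rvec T P le p q u).

Definition Ccone (p q u : T) (w : R * R) : Prop :=
  0 <= fst w /\ 0 <= snd w /\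
  forall z, conv (rpoints T P le p q) z -> dot w z <= dot w (rvec T P le p q u).

Definition Ccoef (p q u : T) (c : R) : Prop :=
  exists alpha beta,
    0 <= beta /\ beta <= alpha /\ alpha <= PI / 2 /\
    (forall w, Ccone p q u w <->
       (0 <= fst w /\ 0 <= snd w /\
        snd w * cos alpha <= fst w * sin alpha /\
        snd w * cos beta >= fst w * sin beta)) /\
    c = sin alpha / (sin alpha + cos alpha) - sin beta / (sin beta + cos beta).

(* f(p) + f(q) >= f(p ∧ q) + Σ_{u ∈ E(p,q)} [C(u;p,q)] f(u),
   zero-coefficient terms omitted *)
Definition submodular (f : T -> ER) : Prop :=
  forall p q, P p -> P q ->
    exists l : list (T * R),
      NoDup (map fst l) /\
      (forall u, (Eset p q u /\ exists c, Ccoef p q u c /\ c <> 0) <->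
                 exists c, In (u, c) l) /\
      (forall u c, In (u, c) l -> Ccoef p q u c /\ c <> 0) /\
      ER_le (fold_right (fun uc acc => ER_add (ER_scale (snd uc) (f (fst uc))) acc)
                        (f (smeet T P le p q)) l)
            (ER_add (f p) (f q)).

End Submod.

(* I*_x : intervals [y,z] (y ⊑ z) with y ⪯ x ⪯ z, represented by the pair (y,z) *)
Definition Istar {V : Type} (arc : V -> V -> Prop) (x : V) (yz : V * V) : Prop :=
  sqsub arc (fst yz) (snd yz) /\ preceq arc (fst yz) x /\ preceq arc x (snd yz).

Definition incl_order {V : Type} (arc : V -> V -> Prop) (a b : V * V) : Prop :=
  forall w, preceq arc (fst a) w -> preceq arc w (snd a) ->
            preceq arc (fst b) w /\ preceq arc w (snd b).

Definition gstar {V : Type} (g : V -> ER) (yz : V * V) : ER :=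
  ER_scale (1 / 2) (ER_add (g (fst yz)) (g (snd yz))).

Definition delta'_connected {V : Type} (arc : V -> V -> Prop) (S : V -> Prop) : Prop :=
  forall x y, S x -> S y -> x <> y ->
    clos_refl_trans V (fun a b => S a /\ S b /\ (sqsub arc a b \/ sqsub arc b a)) x y.

Definition L_convex {V : Type} (arc : V -> V -> Prop) (g : V -> ER) : Prop :=
  delta'_connected arc (in_dom g) /\
  forall x, submodular (V * V) (Istar arc x) (incl_order arc) (gstar g).

Definition discrete_image {V : Type} (g : V -> ER) : Prop :=
  exists eps, 0 < eps /\
    forall x y a b, g x = Fin a -> g y = Fin b ->
      a - eps <= b <= a + eps -> b = a.

Definition minimizer_over {V : Type} (g : V -> ER) (S : V -> Prop) (x : V) : Prop :=
  forall y, S y -> ER_le (g x) (g y).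

(* Main.v *)
Require Import Defs.
From Stdlib Require Import Reals List Relations.
From Stdlib Require Import Classical ClassicalEpsilon Lia Lra Wf_nat.

(** Suppose [x] minimizes [g] over its star but [g y < g x]. Join [y] to [x] by a
    Delta'-path inside [dom g] and lower its maximum [M >= g x]: at a
    vertex [z] of value [M] whose neighbours [a], [b] on the path satisfy
    [g a < M] and [g b <= M], submodularity of [g*] on [I*_z] provides a detour
    from [a] to [b] with all interior values below [M].  Indeed, for incomparable
    [p], [q] with [g*(p), g*(q) <= M], not both equal to [M], either
    [g*(p /\ q) < M] or, the coefficients [[C(u; p, q)]] summing to 1, some
    [u <> p, q] in [I(p, q)] has [g*(u) < M]; then one recurses on [(p, u)] and
    [(u, q)].  The detour is no longer than [d(a, z) + d(z, b)], so all paths stay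
    in one ball around [y].  There the values of [g] are uniformly separated, so
    after finitely many rounds [M = g x], and a last round ends with a Delta'-step
    into [x] from a vertex of value below [g x].

    That the coefficients sum to 1 amounts to the cones [C(u; p, q)] tiling the
    quadrant; that distinct [u] have distinct cones follows from the modular
    semilattice structure of [I*_z], which is derived from the fact that directed
    paths are geodesics and that medians compute joins and meets. *)

(** * Oriented modular graphs *)

(** Submodularity controls only [gstar], the average of [g] over the two ends of an interval,
    whereas a detour needs vertices below [M]. If [a] and [b] lie on the same side of [z], every
    interval met has [z] as one end, whose value is exactly [M], so the average decides the other
    end. On opposite sides it only says that one of the two ends is below [M]; hence the recursion
    there runs over pairs of intervals and spends one good end at a time. That the coefficients sum
    to 1 is a statement about lengths: a coefficient measures the piece that its cone cuts from the
    segment of points [(1 - t, t)], [0 <= t <= 1]. The semilattice [Istar] may be infinite, but for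
    fixed [p], [q] there are only finitely many rank vectors, so finitely many intervals are
    involved. It suffices that one of the two values lies strictly below [M], because incomparable
    [p] and [q] each carry a coefficient below 1: otherwise one of them would maximize both
    coordinates of the rank vector. *)

Section Distance.
Context {T : Type} (adj : T -> T -> Prop).
Hypothesis adj_sym : forall x y, adj x y -> adj y x.

Lemma walk_app x y z m n : walk adj x y m -> walk adj y z n -> walk adj x z (m + n).
Proof.
  induction 1 as [|x w y m H W IH]; simpl; auto.
  intros; econstructor; eauto.
Qed.

Lemma walk_one x y : adj x y -> walk adj x y 1.
Proof. intros; econstructor; eauto; constructor. Qed.

Lemma walk_rev x y n : walk adj x y n -> walk adj y x n.
Proof.
  induction 1 as [|x w y m H W IH]; [constructor|].
  replace (S m) with (m + 1)%nat by lia.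
  eapply walk_app; eauto using walk_one.
Qed.

Lemma gdist_spec x y n : walk adj x y n -> is_dist adj x y (gdist adj x y).
Proof.
  intros W; unfold gdist; apply epsilon_spec.
  destruct (dec_inh_nat_subset_has_unique_least_element (walk adj x y)) as [k [[H1 H2] _]].
  - intros k; apply classic.
  - eauto.
  - exists k; split; auto.
Qed.

Lemma gdist_le x y n : walk adj x y n -> (gdist adj x y <= n)%nat.
Proof. intros W; apply (gdist_spec x y n W); auto. Qed.

Lemma gdist_walk x y n : walk adj x y n -> walk adj x y (gdist adj x y).
Proof. intros W; apply (gdist_spec x y n W); auto. Qed.

Lemma gdist_refl x : gdist adj x x = 0%nat.
Proof. pose proof (gdist_le x x 0 (walk_nil _ x)); lia. Qed.

Hypothesis conn : forall x y, exists n, walk adj x y n.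

Lemma gdist_walk_conn x y : walk adj x y (gdist adj x y).
Proof. destruct (conn x y) as [n W]; eauto using gdist_walk. Qed.

Lemma gdist_sym x y : gdist adj x y = gdist adj y x.
Proof.
  pose proof (gdist_le _ _ _ (walk_rev _ _ _ (gdist_walk_conn x y))).
  pose proof (gdist_le _ _ _ (walk_rev _ _ _ (gdist_walk_conn y x))). lia.
Qed.

Lemma gdist_tri x y z : (gdist adj x z <= gdist adj x y + gdist adj y z)%nat.
Proof. apply gdist_le; eapply walk_app; apply gdist_walk_conn. Qed.

Lemma gdist_zero x y : gdist adj x y = 0%nat -> x = y.
Proof. intros E; pose proof (gdist_walk_conn x y) as W; rewrite E in W; inversion W; auto. Qed.

Lemma gdist_adj_le x y : adj x y -> (gdist adj x y <= 1)%nat.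
Proof. intros; apply gdist_le; apply walk_one; auto. Qed.

Lemma gdist_one x y : gdist adj x y = 1%nat -> adj x y.
Proof.
  intros E; pose proof (gdist_walk_conn x y) as W; rewrite E in W.
  inversion W as [|? ? ? ? H W']; subst; inversion W'; subst; auto.
Qed.

Lemma gdist_step x y : x <> y ->
  exists z, adj x z /\ S (gdist adj z y) = gdist adj x y.
Proof.
  intros N; pose proof (gdist_walk_conn x y) as W.
  inversion W as [|? z ? n H W']; subst; [contradiction|].
  exists z; split; auto.
  pose proof (gdist_le _ _ _ W'); pose proof (gdist_tri x z y);
  pose proof (gdist_adj_le _ _ H); lia.
Qed.

End Distance.

Section OrientedModularGraph.
Context {V : Type} (adj arc : V -> V -> Prop).
Hypothesis HG : simple_connected_graph adj.
Hypothesis Hmod : modular_graph adj.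
Hypothesis Hor : admissible_orientation adj arc.

Local Notation d := (gdist adj).
Local Notation le := (preceq arc).

Let sym : forall x y, adj x y -> adj y x := proj1 HG.
Let conn : forall x y, exists n, walk adj x y n := proj2 (proj2 HG).

Lemma dist_sym x y : d x y = d y x.
Proof. apply gdist_sym; auto. Qed.
Lemma dist_tri x y z : (d x z <= d x y + d y z)%nat.
Proof. apply gdist_tri; auto. Qed.
Lemma dist_refl x : d x x = 0%nat.
Proof. apply gdist_refl. Qed.
Lemma dist_zero x y : d x y = 0%nat -> x = y.
Proof. apply gdist_zero; auto. Qed.
Lemma dist_adj x y : adj x y -> d x y = 1%nat.
Proof.
  intros H; pose proof (gdist_adj_le adj x y H).
  destruct (d x y) as [|[|]] eqn:E; try lia.
  apply dist_zero in E; subst; exfalso; eapply (proj1 (proj2 HG)); eauto.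
Qed.
Lemma dist_step x y : x <> y -> exists z, adj x z /\ S (d z y) = d x y.
Proof. apply gdist_step; auto. Qed.

Lemma arc_adj x y : arc x y -> adj x y.
Proof. apply Hor. Qed.
Lemma arc_asym x y : arc x y -> arc y x -> False.
Proof. intros; eapply (proj2 (proj2 (proj1 Hor))); eauto. Qed.
Lemma adj_arc x y : adj x y -> arc x y \/ arc y x.
Proof. apply Hor. Qed.

(** A median of [x], [y], [z] lies on the edge [xy], so it is one of the two ends, and that end is
    nearer to [z] by one. *)
Lemma bipartite x y z : adj x y -> d x z = S (d y z) \/ d y z = S (d x z).
Proof.
  intros H; destruct (Hmod x y z) as (w & H1 & H2 & H3); unfold ginterval in *.
  pose proof (dist_adj _ _ H) as E; rewrite E in H1.
  destruct (d x w) eqn:E1.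
  - apply dist_zero in E1; subst. rewrite dist_refl in *.
    rewrite (dist_sym y w), E in H2; lia.
  - assert (E2 : d w y = 0%nat) by lia. apply dist_zero in E2; subst.
    rewrite (dist_sym y x), E, (dist_sym z y), (dist_sym z x) in H3; lia.
Qed.

(** The median of [y1], [y2], [u] is equidistant from [y1] and [y2], so [d y1 y2] is even; being
    nonzero and at most 2 it equals 2, and the median is the fourth corner. *)
Lemma quadrangle v y1 y2 u :
  adj v y1 -> adj v y2 -> y1 <> y2 -> d v u = S (d y1 u) -> d v u = S (d y2 u) ->
  exists w, adj y1 w /\ adj y2 w /\ S (d w u) = d y1 u.
Proof.
  intros A1 A2 N E1 E2.
  destruct (Hmod y1 y2 u) as (w & H1 & H2 & H3); unfold ginterval in *.
  pose proof (dist_tri y1 v y2). pose proof (dist_adj _ _ A1). pose proof (dist_adj _ _ A2).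
  rewrite (dist_sym y1 v) in *.
  assert (d y1 y2 <> 0%nat) by (intros E; apply N, dist_zero, E).
  rewrite (dist_sym u y1), (dist_sym u w), (dist_sym w y1) in H3.
  rewrite (dist_sym w y2) in H1.
  assert (d y1 w = 1%nat /\ d y2 w = 1%nat) as [? ?] by lia.
  exists w; repeat split. 1,2: apply gdist_one; auto. lia.
Qed.

Lemma four_cycle_arc x1 x2 x3 x4 :
  adj x1 x2 -> adj x2 x3 -> adj x3 x4 -> adj x4 x1 -> x1 <> x3 -> x2 <> x4 ->
  arc x1 x2 -> arc x4 x3.
Proof. intros; apply (proj2 Hor) with x1 x2; auto; repeat split; auto. Qed.

(** The two claims need a joint induction: if the walk were not a geodesic, [x] would be a neighbour
    of [x1] nearer to [y], and the second claim would give an arc from [x1] back to [x]. The second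
    claim carries the arc from [x1] to [v] across the square [x, x1, v, w] supplied by the
    quadrangle condition. *)
Lemma directed_geodesic n : forall x y, walk arc x y n ->
  d x y = n /\ forall w, adj x w -> S (d w y) = n -> arc x w /\ walk arc w y (d w y).
Proof.
  induction n as [|n IH]; intros x y W; inversion W as [|? x1 ? ? A W1]; subst.
  - split; [apply dist_refl|]; lia.
  - destruct (IH _ _ W1) as [E1 Q1]. pose proof (arc_adj _ _ A) as B.
    assert (E : d x y = S n).
    { destruct (bipartite x x1 y B) as [E|E]; [lia|].
      destruct (Q1 x) as [C _]; auto; [lia|]. exfalso; eauto using arc_asym. }
    split; auto. intros w C Ew.
    destruct (classic (w = x1)) as [->|N]; [rewrite E1; auto|].
    destruct (quadrangle x x1 w y) as (v & V1 & V2 & V3); auto; try lia.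
    destruct (Q1 v) as [C1 C2]; auto; [lia|].
    assert (x <> v) by (intros ->; lia).
    assert (arc w v) by (apply (four_cycle_arc x x1 v w); auto).
    assert (arc x w) by (apply (four_cycle_arc x1 v w x); auto).
    split; auto. replace (d w y) with (S (d v y)) by lia.
    econstructor; eauto.
Qed.

Lemma walk_le x y n : walk arc x y n -> le y x.
Proof.
  induction 1; [apply rt_refl|].
  eapply rt_trans; [apply rt_step|]; eauto.
Qed.

Lemma le_walk x y : le y x -> walk arc x y (d x y).
Proof.
  intros H; apply clos_rt_rt1n in H.
  assert (exists n, walk arc x y n) as [n W].
  { induction H as [x|x z y A _ [n W]]; eexists; econstructor; eauto. }
  rewrite (proj1 (directed_geodesic _ _ _ W)); auto.
Qed.

Lemma preceq_refl x : le x x.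
Proof. apply rt_refl. Qed.
Lemma preceq_trans x y z : le x y -> le y z -> le x z.
Proof. intros; eapply rt_trans; eauto. Qed.
Lemma arc_le x y : arc x y -> le y x.
Proof. apply rt_step. Qed.

Lemma le_between x y z : le y x -> (d x z + d z y)%nat = d x y -> le y z /\ le z x.
Proof.
  remember (d x z) as n eqn:E; revert x E; induction n as [|n IH]; intros x E H I.
  - symmetry in E; apply dist_zero in E; subst; auto using preceq_refl.
  - destruct (dist_step x z) as (w & A & Ew); [intros ->; rewrite dist_refl in E; lia|].
    pose proof (dist_tri w z y). pose proof (dist_tri x w y). rewrite (dist_adj _ _ A) in *.
    destruct (proj2 (directed_geodesic _ _ _ (le_walk _ _ H)) w) as [B W]; auto; [lia|].
    destruct (IH w) as [? ?]; [lia|eapply walk_le; eauto|lia|].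
    split; auto. eapply preceq_trans; eauto using arc_le.
Qed.

(** Makes [d p] a rank function on the elements above [p]; the rank counts below rest on this
    additivity. *)
Lemma preceq_dist x y z : le x y -> le y z -> d x z = (d x y + d y z)%nat.
Proof.
  intros H1 H2.
  assert (W := walk_app _ _ _ _ _ _ (le_walk _ _ H2) (le_walk _ _ H1)).
  rewrite (dist_sym x z), (proj1 (directed_geodesic _ _ _ W)), (dist_sym x y), (dist_sym y z); lia.
Qed.

Lemma preceq_antisym x y : le x y -> le y x -> x = y.
Proof.
  intros H1 H2; pose proof (preceq_dist _ _ _ H1 H2) as E.
  rewrite dist_refl in E; apply dist_zero; lia.
Qed.

Lemma le_adj_arc x y : le x y -> adj y x -> arc y x.
Proof.
  intros H A. destruct (proj2 (directed_geodesic _ _ _ (le_walk _ _ H)) x) as [B W]; auto.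
  rewrite dist_refl, dist_adj; auto.
Qed.

(* An upper neighbour [e] of [s] that is closer to [s'] lies below every common
   upper bound [w] of [s] and [s']: otherwise the quadrangle condition pushes the
   arc [e -> s] along a geodesic from [s] up to [w]. *)
Lemma upper_neighbour_le n : forall s e s' w, d s w = n -> le s w -> le s' w ->
  arc e s -> S (d e s') = d s s' -> le e w.
Proof.
  induction n as [n IH] using lt_wf_ind; intros s e s' w En Hs Hs' A D.
  apply NNPP; intros C.
  pose proof (arc_adj _ _ A) as B. pose proof (dist_adj _ _ B) as B1.
  assert (E : d e w = S n).
  { destruct (bipartite e s w B) as [E|E]; [lia|].
    exfalso; apply C. destruct (le_between w s e) as [? ?]; auto.
    rewrite (dist_sym w e), (dist_sym w s); lia. }
  destruct (Hmod e s' w) as (m & M1 & M2 & M3); unfold ginterval in *.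
  destruct (classic (e = m)) as [->|N].
  { apply C. apply (le_between w s'); auto.
    rewrite (dist_sym w m), (dist_sym w s'), (dist_sym m s'), (dist_sym m w) in *; lia. }
  destruct (dist_step e m N) as (e' & A' & D').
  pose proof (dist_tri e' m s'). pose proof (dist_tri e' m w). pose proof (dist_tri e e' s').
  pose proof (dist_tri e e' w). pose proof (dist_adj _ _ A').
  rewrite (dist_sym w m), (dist_sym w e), (dist_sym m e) in *.
  assert (e' <> s) by (intros ->; lia).
  destruct (quadrangle e e' s w) as (x & X1 & X2 & X3); auto; try lia.
  destruct (le_between w s x) as [L1 L2]; auto.
  { rewrite (dist_sym w x), (dist_sym w s), (dist_sym x s), (dist_adj _ _ X2); lia. }
  assert (e <> x) by (intros ->; lia).
  assert (A2 : arc e' x) by (apply (four_cycle_arc e s x e'); auto).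
  pose proof (dist_tri s x s'). pose proof (dist_tri x e' s').
  pose proof (dist_adj _ _ X2). pose proof (dist_adj _ _ X1). rewrite (dist_sym e' x) in *.
  (* Induction puts [e'] between [x] and [w], so [d e' w < d x w]; but [x] was chosen nearer to [w]
     than [e']. *)
  assert (L3 : le e' w) by (apply (IH (d x w)) with x s'; auto; lia).
  pose proof (preceq_dist _ _ _ (arc_le _ _ A2) L3). lia.
Qed.

(** Walk along a geodesic from [s] through [m]: a downward step stays below [w] by transitivity, an
    upward step by [upper_neighbour_le]. *)
Lemma interval_below s s' w m : le s w -> le s' w ->
  (d s m + d m s')%nat = d s s' -> le m w.
Proof.
  remember (d s m) as n eqn:E; revert s E; induction n as [|n IH]; intros s E H H' I.
  - symmetry in E; apply dist_zero in E; subst; auto.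
  - destruct (dist_step s m) as (e & A & Ee); [intros ->; rewrite dist_refl in E; lia|].
    pose proof (dist_tri e m s'). pose proof (dist_tri s e s'). rewrite (dist_adj _ _ A) in *.
    apply (IH e); auto; try lia.
    destruct (adj_arc _ _ A) as [B|B].
    + eapply preceq_trans; eauto using arc_le.
    + eapply upper_neighbour_le with (s := s) (s' := s'); eauto; lia.
Qed.

Definition lub_of x y j := le x j /\ le y j /\ forall w, le x w -> le y w -> le j w.
Definition glb_of x y m := le m x /\ le m y /\ forall w, le w x -> le w y -> le w m.

(** The median of [s], [s'] and one common bound [w] is the join: it lies above both, being between
    each of them and [w], and below every common bound, being between [s] and [s']. *)
Lemma lub_exists s s' w : le s w -> le s' w -> exists j, lub_of s s' j.
Proof.
  intros H H'; destruct (Hmod s s' w) as (j & J1 & J2 & J3); unfold ginterval in *.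
  exists j; repeat split.
  - apply (le_between w s); auto. 
  - apply (le_between w s'); auto. rewrite (dist_sym w j), (dist_sym j s'), (dist_sym w s'); lia.
  - intros; eapply interval_below with (s := s) (s' := s'); eauto.
Qed.

(** A median of [x], [y], [j] is an upper bound of [x] and [y] below [j], hence it is [j]. *)
Lemma lub_dist x y j : lub_of x y j -> (d x j + d j y)%nat = d x y.
Proof.
  intros (A & B & C); destruct (Hmod x y j) as (m & M1 & M2 & M3); unfold ginterval in *.
  assert (le j m) as L.
  { apply C; [apply (le_between j x)|apply (le_between j y)]; auto.
    rewrite (dist_sym j m), (dist_sym m y), (dist_sym j y); lia. }
  assert (m = j) as ->; auto.
  apply preceq_antisym; auto. apply (le_between j x); auto.
Qed.

End OrientedModularGraph.

(** * Order duality: reversing all arcs exchanges joins and meets *)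

Section Duality.
Context {V : Type} (adj arc : V -> V -> Prop).

Definition flip_arc (x y : V) : Prop := arc y x.

Lemma flip_admissible : (forall x y, adj x y -> adj y x) ->
  admissible_orientation adj arc -> admissible_orientation adj flip_arc.
Proof.
  intros sym [(H1 & H2 & H3) H4]; unfold flip_arc; repeat split.
  - auto.
  - intros x y H; destruct (H2 x y); auto.
  - intros x y [? ?]; eapply H3; eauto.
  - intros x1 x2 x3 x4 (A1 & A2 & A3 & A4 & N1 & N2) A.
    apply (H4 x2 x1 x4 x3); auto; repeat split; auto.
Qed.

Lemma flip_le p q : preceq flip_arc p q <-> preceq arc q p.
Proof.
  unfold preceq; split; induction 1;
    try solve [apply rt_refl | apply rt_step; auto | eapply rt_trans; eauto].
Qed.

Lemma flip_lub x y j : lub_of flip_arc x y j <-> glb_of arc x y j.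
Proof.
  unfold lub_of, glb_of; rewrite !flip_le; split; intros (A & B & C);
    repeat split; auto; intros w; specialize (C w); rewrite !flip_le in *; auto.
Qed.

Lemma flip_glb x y j : glb_of flip_arc x y j <-> lub_of arc x y j.
Proof.
  unfold lub_of, glb_of; rewrite !flip_le; split; intros (A & B & C);
    repeat split; auto; intros w; specialize (C w); rewrite !flip_le in *; auto.
Qed.

End Duality.

(** * Rank, atoms and complements in intervals *)

Section IntervalLattices.
Context {V : Type} (adj arc : V -> V -> Prop).
Hypothesis HG : simple_connected_graph adj.
Hypothesis Hmod : modular_graph adj.
Hypothesis Hor : admissible_orientation adj arc.

Local Notation d := (gdist adj).
Local Notation le := (preceq arc).

Let Hflip : admissible_orientation adj (flip_arc arc) :=
  flip_admissible adj arc (proj1 HG) Hor.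
Let dsym := dist_sym adj HG.
Let ladd := preceq_dist adj arc HG Hmod Hor.

Lemma glb_exists s s' w : le w s -> le w s' -> exists m, glb_of arc s s' m.
Proof.
  intros H H'; destruct (lub_exists adj (flip_arc arc) HG Hmod Hflip s s' w) as [m M];
    [apply flip_le; auto..|].
  exists m; apply flip_lub; auto.
Qed.

Lemma glb_dist x y j : glb_of arc x y j -> (d x j + d j y)%nat = d x y.
Proof. intros H; apply (lub_dist adj (flip_arc arc) HG Hmod Hflip); apply flip_lub; auto. Qed.

Lemma interval_above s s' w m : le w s -> le w s' ->
  (d s m + d m s')%nat = d s s' -> le w m.
Proof.
  rewrite <- !(flip_le arc); apply (interval_below adj (flip_arc arc) HG Hmod Hflip).
Qed.

(** The route from [x] to [y] over [m] and the route over [j] both have length [d x y]; additivity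
    turns the two lengths into ranks over [b]. *)
Lemma rank_modular b x y m j : le b x -> le b y -> glb_of arc x y m -> lub_of arc x y j ->
  (d b m + d b j)%nat = (d b x + d b y)%nat.
Proof.
  intros Hx Hy M J.
  pose proof (glb_dist _ _ _ M). pose proof (lub_dist adj arc HG Hmod Hor _ _ _ J).
  destruct M as (M1 & M2 & M3), J as (J1 & J2 & J3).
  pose proof (ladd b m x (M3 _ Hx Hy) M1). pose proof (ladd b m y (M3 _ Hx Hy) M2).
  pose proof (ladd b x j Hx J1). pose proof (ladd b y j Hy J2).
  rewrite (dsym x m), (dsym j y) in *. lia.
Qed.

(* A median of [a], [b], [c] is such a bound. *)
Lemma triple_bounded z x y w a b c : le z x -> le z y -> le z w ->
  le x a -> le y a -> le x b -> le w b -> le y c -> le w c ->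
  exists t, le x t /\ le y t /\ le w t.
Proof.
  intros; destruct (Hmod a b c) as (m & M1 & M2 & M3); unfold ginterval in *.
  exists m; repeat split.
  - apply interval_above with a b; auto.
  - apply interval_above with c a; auto.
  - apply interval_above with b c; auto.
Qed.

(** Complementedness in the lattice sense, shown equivalent to [sqsub] in [sqsub_compl]. Unlike the
    condition on atoms it is visibly self-dual, which is what allows the lower end of an interval to
    be moved as well. *)
Definition compl p q := le p q /\ forall v, le p v -> le v q ->
  exists c, le p c /\ le c q /\ glb_of arc v c p /\ lub_of arc v c q.

Lemma covers_pre_arc p a : covers_pre arc p a <-> arc a p.
Proof.
  split.
  - intros (H & N & C). destruct (le_walk adj arc HG Hmod Hor _ _ H) as [|a z p n A W]; [tauto|].
    destruct (C z) as [->| ->]; auto.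
    + eapply walk_le; eauto.
    + apply arc_le; auto.
    + exfalso; eapply (arc_asym adj arc Hor); eauto.
  - intros A; repeat split.
    + apply arc_le; auto.
    + intros ->; eapply (arc_asym adj arc Hor); eauto.
    + intros z H1 H2. pose proof (ladd _ _ _ H1 H2) as E.
      rewrite (dsym p a), (dist_adj adj HG _ _ (arc_adj adj arc Hor _ _ A)) in E.
      destruct (d p z) eqn:E1; [left|right].
      * symmetry; apply (dist_zero adj HG); auto.
      * apply (dist_zero adj HG); lia.
Qed.

(** The true join lies below [j], and by [rank_modular] its rank is already at least that of [j]. *)
Lemma lub_of_rank b x y j m : le b x -> le b y -> glb_of arc x y m -> le x j -> le y j ->
  (d b m + d b j <= d b x + d b y)%nat -> lub_of arc x y j.
Proof.
  intros Bx By M Hx Hy H.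
  destruct (lub_exists adj arc HG Hmod Hor x y j Hx Hy) as [j' J].
  pose proof (rank_modular b _ _ _ _ Bx By M J).
  assert (L : le j' j) by (apply J; auto).
  pose proof (ladd b j' j (preceq_trans _ _ _ _ Bx (proj1 J)) L).
  rewrite (dist_zero adj HG j' j) in J; auto; lia.
Qed.

(** If [c] complements [v] in the large interval, its meet [c'] with [q'] does so in the small one.
    The join of [c] and [q'] is [q] because [v] is below [q']; so the rank of [c'] over [p] is that
    of [q'] minus that of [v], and [lub_of_rank] applies. *)
Lemma compl_lower p q q' : compl p q -> le p q' -> le q' q -> compl p q'.
Proof.
  intros [Hpq C] H1 H2; split; auto; intros v V1 V2.
  destruct (C v) as (c & C1 & C2 & M & J); auto; [eapply preceq_trans; eauto|].
  destruct (glb_exists c q' p C1 H1) as [c' M'].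
  destruct (lub_exists adj arc HG Hmod Hor c q' q C2 H2) as [k K].
  assert (k = q) as ->.
  { apply (preceq_antisym adj arc HG Hmod Hor); [apply K; auto|].
    apply J; [|apply K]. eapply preceq_trans; [eauto|apply K]. }
  pose proof (rank_modular p _ _ _ _ C1 H1 M' K).
  pose proof (rank_modular p _ _ _ _ V1 C1 M J).
  rewrite dist_refl in *.
  assert (P' : le p c') by (apply M'; auto).
  assert (M2 : glb_of arc v c' p).
  { repeat split; auto. intros w W1 W2; apply M; auto.
    apply preceq_trans with c'; [auto|apply M']. }
  exists c'; repeat split; auto; try apply M'; try apply M2.
  - intros w W1 W2. assert (J2 : lub_of arc v c' q').
    { apply lub_of_rank with p p; auto; [apply M'|]. rewrite dist_refl; lia. }
    apply J2; auto.
Qed.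

Lemma atom_below p e : le p e -> p <> e -> exists a, arc a p /\ le a e.
Proof.
  intros H N; destruct (dist_step adj HG p e N) as (a & A & E).
  destruct (le_between adj arc HG Hmod Hor e p a) as [L1 L2]; auto.
  - rewrite (dsym e a), (dsym a p), (dsym e p), (dist_adj adj HG _ _ A); lia.
  - exists a; split; auto. apply (le_adj_arc adj arc HG Hmod Hor); auto.
    apply HG; auto.
Qed.

(** The partial join [v] grows towards [w]. For a complement [c] of [v], the meet [e] of [w] and [c]
    has rank [d v w], so it dominates an atom; that atom is not below [v], since otherwise it would
    be below the meet [p] of [v] and [c]. *)
Lemma atomistic_join p q : compl p q -> forall n w v l, d v w = n -> le v w -> le w q ->
  (forall a, In a l -> arc a p) -> join_in arc p q l v ->
  exists l', (forall a, In a l' -> arc a p) /\ join_in arc p q l' w.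
Proof.
  intros [Hpq C]; induction n as [n IH] using lt_wf_ind; intros w v l En Vw Wq Ap J.
  destruct (classic (v = w)) as [->|N]; [exists l; auto|].
  destruct J as (J1 & J2 & J3 & J4).
  destruct (C v) as (c & C1 & C2 & M & K); auto.
  assert (Pw : le p w) by (eauto using preceq_trans).
  destruct (glb_exists w c p Pw C1) as [e E].
  assert (K' : lub_of arc w c q).
  { repeat split; auto. intros u U1 U2; apply K; auto. eauto using preceq_trans. }
  pose proof (rank_modular p _ _ _ _ Pw C1 E K').
  pose proof (rank_modular p _ _ _ _ J1 C1 M K).
  pose proof (ladd p v w J1 Vw). rewrite dist_refl in *.
  assert (d v w <> 0%nat) by (intros Z; apply N, (dist_zero adj HG), Z).
  destruct (atom_below p e) as (a & A & Ae).
  { apply E; auto. }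
  { intros <-; rewrite dist_refl in *; lia. }
  assert (Na : ~ le a v).
  { intros L. assert (L' : le a p).
    { apply M; auto. apply preceq_trans with e; [auto|apply E]. }
    assert (a = p) as -> by (apply (preceq_antisym adj arc HG Hmod Hor); auto using arc_le).
    eapply (arc_asym adj arc Hor); eauto. }
  assert (Aw : le a w) by (apply preceq_trans with e; [auto|apply E]).
  destruct (lub_exists adj arc HG Hmod Hor v a w Vw Aw) as [v' V'].
  assert (Lw : le v' w) by (apply V'; auto).
  assert (d v v' <> 0%nat).
  { intros Z; apply (dist_zero adj HG) in Z; subst v'; apply Na, V'. }
  pose proof (ladd v v' w (proj1 V') Lw).
  apply (IH (d v' w)) with (v := v') (l := a :: l); auto; try lia.
  - intros b [<-|B]; auto.
  - repeat split.
    + eapply preceq_trans; [apply J1|apply V'].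
    + eauto using preceq_trans.
    + intros b [<-|B]; [apply V'|]. eapply preceq_trans; [apply J3; auto|apply V'].
    + intros u U1 U2 U3. apply V'; [apply J4; auto|apply U3; left; auto].
      intros b B; apply U3; right; auto.
Qed.

(** A basis exchange: an atom not yet below [k] is joined to [c]. This raises the rank of [c] by at
    most one and that of [k] by at least one, so the modular identity forces the meet with [v] to
    stay [p]. *)
Lemma greedy_complement p q v l : le p v -> le v q -> (forall a, In a l -> arc a p /\ le a q) ->
  exists c k, le p c /\ le c q /\ glb_of arc v c p /\ lub_of arc v c k /\
    forall a, In a l -> le a k.
Proof.
  intros V1 V2; induction l as [|a l IH]; intros A.
  - exists p, v; repeat split; auto using preceq_refl; [|intros a []].
    apply preceq_trans with v; auto.
  - destruct IH as (c & k & C1 & C2 & M & K & L); [intros; apply A; right; auto|].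
    destruct (A a) as [A1 A2]; [left; auto|].
    destruct (classic (le a k)) as [Hk|Hk].
    { exists c, k; split; [|split; [|split; [|split]]]; auto. intros b [<-|B]; auto. }
    assert (Pa : le p a) by (apply arc_le; auto).
    destruct (lub_exists adj arc HG Hmod Hor c a q C2 A2) as [c' C'].
    assert (C'q : le c' q) by (apply C'; auto).
    destruct (lub_exists adj arc HG Hmod Hor v c' q V2 C'q) as [k' K'].
    assert (Pc' : le p c') by (eapply preceq_trans; [apply C1|apply C']).
    destruct (glb_exists c a p C1 Pa) as [g G].
    destruct (glb_exists v c' p V1 Pc') as [h H].
    pose proof (rank_modular p _ _ _ _ C1 Pa G C').
    pose proof (rank_modular p _ _ _ _ V1 Pc' H K').
    pose proof (rank_modular p _ _ _ _ V1 C1 M K).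
    assert (Lk : le k k').
    { apply K; [apply K'|]. eapply preceq_trans; [apply C'|apply K']. }
    assert (Pk : le p k) by (eapply preceq_trans; [apply V1|apply K]).
    pose proof (ladd p k k' Pk Lk).
    assert (d k k' <> 0%nat).
    { intros Z; apply (dist_zero adj HG) in Z; subst k'; apply Hk.
      eapply preceq_trans; [apply C'|apply K']. }
    assert (d p a = 1%nat).
    { rewrite dsym; apply (dist_adj adj HG), (arc_adj adj arc Hor); auto. }
    assert (le p h) by (apply H; auto).
    rewrite dist_refl in *.
    assert (p = h) as -> by (apply (dist_zero adj HG); lia).
    exists c', k'; split; [|split; [|split; [|split]]]; auto.
    intros b [<-|B].
    + eapply preceq_trans; [apply C'|apply K'].
    + eauto using preceq_trans.
Qed.

Lemma compl_of_atoms p q l : le p q -> (forall a, In a l -> arc a p /\ le a q) ->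
  (forall u, le p u -> (forall a, In a l -> le a u) -> le q u) -> compl p q.
Proof.
  intros H A U; split; auto; intros v V1 V2.
  destruct (greedy_complement p q v l V1 V2 A) as (c & k & C1 & C2 & M & K & L).
  exists c; split; [|split; [|split]]; auto.
  assert (k = q) as <-; auto.
  apply (preceq_antisym adj arc HG Hmod Hor); [apply K; auto|].
  apply U; auto. eapply preceq_trans; [apply V1|apply K].
Qed.

Lemma sqsub_atoms p q : sqsub arc p q ->
  exists l, (forall a, In a l -> arc a p /\ le a q) /\
    (forall u, le p u -> (forall a, In a l -> le a u) -> le q u).
Proof.
  intros [H S]; destruct (S q) as (l & L & J1 & J2 & J3 & J4); auto using preceq_refl.
  exists l; split.
  - intros a A; split; auto. apply covers_pre_arc; auto.
  - intros u U1 U2. destruct (glb_exists u q p U1 H) as [g G].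
    (* [join_in] compares only with bounds inside the interval, hence the passage from [u] to its
       meet [g] with [q]. *)
    apply preceq_trans with g; [|apply G].
    apply J4; [apply G; auto|apply G|]. intros a A; apply G; auto.
Qed.

Lemma sqsub_compl p q : sqsub arc p q <-> compl p q.
Proof.
  split.
  - intros S; destruct (sqsub_atoms p q S) as (l & L1 & L2).
    eapply compl_of_atoms; eauto. apply S.
  - intros C; split; [apply C|]. intros z Z1 Z2.
    destruct (atomistic_join p q C (d p z) z p nil) as (l & L & J); auto.
    + simpl; tauto.
    + repeat split; auto using preceq_refl; [apply C|simpl; tauto].
    + exists l; split; auto. intros a A; apply covers_pre_arc; auto.
Qed.

(** The atoms generating [t] together with those generating [t'] generate [j]. *)
Lemma compl_lub p t t' j : compl p t -> compl p t' -> lub_of arc t t' j -> compl p j.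
Proof.
  intros C C' J. destruct (sqsub_atoms p t) as (l & L1 & L2); [apply sqsub_compl; auto|].
  destruct (sqsub_atoms p t') as (l' & L1' & L2'); [apply sqsub_compl; auto|].
  apply compl_of_atoms with (l ++ l').
  - eapply preceq_trans; [apply C|apply J].
  - intros a A; apply in_app_or in A; destruct A as [A|A];
      [destruct (L1 a A)|destruct (L1' a A)]; split; auto;
      (eapply preceq_trans; [eassumption|apply J]).
  - intros u U1 U2; apply J; [apply L2|apply L2']; auto; intros; apply U2, in_or_app; auto.
Qed.

End IntervalLattices.

(** * Stability of [sqsub] under shrinking, joins and meets *)

Section SquareOrder.
Context {V : Type} (adj arc : V -> V -> Prop).
Hypothesis HG : simple_connected_graph adj.
Hypothesis Hmod : modular_graph adj.
Hypothesis Hor : admissible_orientation adj arc.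

Local Notation le := (preceq arc).
Let Hflip : admissible_orientation adj (flip_arc arc) :=
  flip_admissible adj arc (proj1 HG) Hor.

Lemma compl_flip p q : compl (flip_arc arc) q p <-> compl arc p q.
Proof.
  unfold compl; rewrite flip_le; split; intros [H C]; split; auto; intros v V1 V2;
    (destruct (C v) as (c & C1 & C2 & M & J); [apply flip_le; auto..|]);
    apply flip_le in C1, C2; apply flip_glb in M; apply flip_lub in J; eauto.
Qed.

(** Moving the upper end is [compl_lower]; moving the lower end is the same lemma for the reversed
    arcs. *)
Lemma sqsub_interval p q p' q' : sqsub arc p q -> le p p' -> le p' q' -> le q' q ->
  sqsub arc p' q'.
Proof.
  intros S H1 H2 H3. rewrite (sqsub_compl adj arc HG Hmod Hor) in *.
  apply compl_flip. apply (compl_lower adj (flip_arc arc) HG Hmod Hflip _ p);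
    try apply flip_le; auto.
  apply compl_flip. apply (compl_lower adj arc HG Hmod Hor _ q); eauto using preceq_trans.
Qed.

Lemma sqsub_lub p t t' j : sqsub arc p t -> sqsub arc p t' -> lub_of arc t t' j -> sqsub arc p j.
Proof. rewrite !(sqsub_compl adj arc HG Hmod Hor). apply (compl_lub adj arc HG Hmod Hor). Qed.

Lemma sqsub_glb s s' q m : sqsub arc s q -> sqsub arc s' q -> glb_of arc s s' m -> sqsub arc m q.
Proof.
  rewrite !(sqsub_compl adj arc HG Hmod Hor), <- !compl_flip, <- flip_lub.
  apply (compl_lub adj (flip_arc arc) HG Hmod Hflip).
Qed.

Lemma sqsub_refl p : sqsub arc p p.
Proof.
  split; [apply preceq_refl|]. intros z H1 H2.
  assert (z = p) as -> by (apply (preceq_antisym adj arc HG Hmod Hor); auto).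
  exists nil; split; [intros a []|]. repeat split; auto using preceq_refl. intros a [].
Qed.

End SquareOrder.

(** * Modular semilattices *)

Section Semilattice.
Context {T : Type} (P : T -> Prop) (le : T -> T -> Prop) (r : T -> nat) (bot : T).

Definition is_meet p q m := P m /\ le m p /\ le m q /\
  forall z, P z -> le z p -> le z q -> le z m.
Definition is_join p q j := P j /\ le p j /\ le q j /\
  forall z, P z -> le p z -> le q z -> le j z.

Record modular_semilattice : Prop := {
  ms_refl : forall a, P a -> le a a;
  ms_trans : forall a b c, P a -> P b -> P c -> le a b -> le b c -> le a c;
  ms_antisym : forall a b, P a -> P b -> le a b -> le b a -> a = b;
  ms_bot : P bot;
  ms_bot_le : forall a, P a -> le bot a;
  ms_bot_rank : r bot = 0%nat;
  ms_cover : forall a b, scovers T P le a b -> r b = S (r a);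
  ms_chain : forall a b, P a -> P b -> le a b -> exists n, cov_chain T P le a b n;
  ms_meet : forall p q, P p -> P q -> exists m, is_meet p q m;
  ms_join : forall p q u, P p -> P q -> P u -> le p u -> le q u -> exists j, is_join p q j;
  ms_modular : forall p q m j, P p -> P q -> is_meet p q m -> is_join p q j ->
    (r m + r j)%nat = (r p + r q)%nat;
  ms_triple : forall x y w a b c, P x -> P y -> P w -> P a -> P b -> P c ->
    le x a -> le y a -> le x b -> le w b -> le y c -> le w c ->
    exists t, P t /\ le x t /\ le y t /\ le w t }.

Hypothesis MS : modular_semilattice.

Let le_rfl := ms_refl MS.
Let le_tr := ms_trans MS.
Let le_asym := ms_antisym MS.
Let bot_P := ms_bot MS.
Let bot_le := ms_bot_le MS.
Let bot_rank := ms_bot_rank MS.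
Let rank_cover := ms_cover MS.
Let chain_exists := ms_chain MS.
Let meet_exists := ms_meet MS.
Let join_exists := ms_join MS.
Let rank_meet_join := ms_modular MS.
Let triple_join := ms_triple MS.

Local Notation meet := (smeet T P le).
Local Notation cadj := (cov_adj T P le).

Lemma chain_rank a b n : cov_chain T P le a b n -> r b = (r a + n)%nat.
Proof.
  induction 1 as [|a b c n H _ IH]; [lia|]. rewrite IH, (rank_cover _ _ H); lia.
Qed.

Lemma chain_le a b : P a -> P b -> le a b -> cov_chain T P le a b (r b - r a).
Proof.
  intros Ha Hb L; destruct (chain_exists a b Ha Hb L) as [n C].
  replace (r b - r a)%nat with n; auto. pose proof (chain_rank _ _ _ C); lia.
Qed.

Lemma rank_mono a b : P a -> P b -> le a b -> (r a <= r b)%nat.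
Proof. intros Ha Hb L; pose proof (chain_rank _ _ _ (chain_le a b Ha Hb L)); lia. Qed.

Lemma rank_strict a b : P a -> P b -> le a b -> (r b <= r a)%nat -> a = b.
Proof.
  intros Ha Hb L R; pose proof (chain_le a b Ha Hb L) as C.
  replace (r b - r a)%nat with 0%nat in C by lia; inversion C; auto.
Qed.

Lemma smeet_spec p q : P p -> P q -> is_meet p q (meet p q).
Proof. intros Hp Hq; unfold smeet; apply epsilon_spec, meet_exists; auto. Qed.

Lemma meet_unique p q m m' : is_meet p q m -> is_meet p q m' -> m = m'.
Proof. intros (A & B & C & D) (A' & B' & C' & D'); apply le_asym; auto. Qed.

Lemma meet_comm p q m : is_meet p q m -> is_meet q p m.
Proof. intros (A & B & C & D); repeat split; auto. Qed.

Lemma smeet_le p q : P p -> P q -> le p q -> meet p q = p.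
Proof.
  intros Hp Hq L; apply (meet_unique p q); [apply smeet_spec; auto|].
  repeat split; auto.
Qed.

Lemma srank_rank u : P u -> srank T P le u = r u.
Proof.
  intros Hu.
  assert (B : sbottom T P le u = bot).
  { assert (S : P (sbottom T P le u) /\ forall z, P z -> le (sbottom T P le u) z).
    { unfold sbottom; apply epsilon_spec; eauto. }
    destruct S; apply le_asym; auto. }
  assert (C : cov_chain T P le (sbottom T P le u) u (srank T P le u)).
  { unfold srank; apply epsilon_spec. rewrite B; eauto. }
  rewrite B in C; pose proof (chain_rank _ _ _ C); lia.
Qed.

Lemma cov_sym a b : cadj a b -> cadj b a.
Proof. unfold cov_adj; tauto. Qed.

Lemma chain_walk a b n : cov_chain T P le a b n -> walk cadj a b n.
Proof. induction 1; econstructor; eauto; left; auto. Qed.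

(** The join of [m'] and [a] lies between [a] and its cover [b], and [m] is the meet of [m'] and
    [a]; so [m'] exceeds [m] in rank by no more than [b] exceeds [a]. *)
Lemma meet_cover a b q m m' : P q -> scovers T P le a b -> is_meet a q m -> is_meet b q m' ->
  (r m <= r m' <= r m + 1)%nat.
Proof.
  intros Hq C (M1 & M2 & M3 & M4) (N1 & N2 & N3 & N4).
  pose proof (rank_cover _ _ C) as R. destruct C as (Pa & Pb & L & _ & _).
  assert (Lm : le m m') by (apply N4; eauto).
  pose proof (rank_mono m m' M1 N1 Lm).
  destruct (join_exists m' a b) as [j J]; auto.
  assert (M : is_meet m' a m) by (repeat split; eauto).
  pose proof (rank_meet_join _ _ _ _ N1 Pa M J).
  pose proof (rank_mono j b (proj1 J) Pb (proj2 (proj2 (proj2 J)) _ Pb N2 L)). lia.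
Qed.

(** With [q] fixed, [r p - 2 * r m] changes by exactly one along each covering step, by
    [meet_cover], and it ends at [- r q]. *)
Lemma walk_rank p q m n : walk cadj p q n -> P p -> P q -> is_meet p q m ->
  (r p + r q <= n + 2 * r m)%nat.
Proof.
  intros W; revert m; induction W as [p|p w q n A W IH]; intros m Hp Hq M.
  - assert (m = p) as -> by (apply (meet_unique p p); auto; repeat split; auto). lia.
  - assert (Pw : P w) by (destruct A as [A|A]; apply A).
    destruct (meet_exists w q Pw Hq) as [m' M'].
    specialize (IH m' Pw Hq M'). destruct A as [A|A]; pose proof (rank_cover _ _ A).
    + pose proof (meet_cover _ _ _ _ _ Hq A M M'). lia.
    + pose proof (meet_cover _ _ _ _ _ Hq A M' M). lia.
Qed.

Lemma gdist_rank p q m : P p -> P q -> is_meet p q m ->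
  (gdist cadj p q + 2 * r m)%nat = (r p + r q)%nat.
Proof.
  intros Hp Hq M. destruct M as (M1 & M2 & M3 & M4) eqn:E; clear E.
  pose proof (walk_rev cadj cov_sym _ _ _ (chain_walk _ _ _ (chain_le m p M1 Hp M2))) as W1.
  pose proof (chain_walk _ _ _ (chain_le m q M1 Hq M3)) as W2.
  pose proof (walk_app _ _ _ _ _ _ W1 W2) as W.
  pose proof (gdist_le _ _ _ _ W).
  pose proof (walk_rank _ _ m _ (gdist_walk _ _ _ _ W) Hp Hq M).
  pose proof (rank_mono m p M1 Hp M2). pose proof (rank_mono m q M1 Hq M3). lia.
Qed.

(** With [a], [b] the meets of [u] with [p], [q], with [n], [j] the meet and join of [a], [b], and
    with [m] the meet of [p], [q], the excess of the route over [u] is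
    [2 * ((r u - r j) + (r m - r n))]. Both brackets are nonnegative, so on a geodesic both
    vanish. *)
Lemma Icov_spec p q u : P p -> P q -> Icov T P le p q u ->
  is_join (meet u p) (meet u q) u /\ is_meet (meet u p) (meet u q) (meet p q).
Proof.
  intros Hp Hq [Hu I]; unfold ginterval in I.
  pose proof (smeet_spec u p Hu Hp) as A. pose proof (smeet_spec u q Hu Hq) as B.
  pose proof (smeet_spec p q Hp Hq) as M.
  set (a := meet u p) in *; set (b := meet u q) in *; set (m := meet p q) in *.
  pose proof (gdist_rank p q m Hp Hq M).
  pose proof (gdist_rank p u a Hp Hu (meet_comm _ _ _ A)).
  pose proof (gdist_rank u q b Hu Hq B).
  destruct A as (A1 & A2 & A3 & A4), B as (B1 & B2 & B3 & B4), M as (M1 & M2 & M3 & M4).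
  destruct (meet_exists a b A1 B1) as [n N].
  destruct (join_exists a b u A1 B1 Hu A2 B2) as [j J].
  pose proof (rank_meet_join _ _ _ _ A1 B1 N J).
  destruct N as (N1 & N2 & N3 & N4) eqn:EN; destruct J as (J1 & J2 & J3 & J4) eqn:EJ.
  assert (Lj : le j u) by auto. assert (Ln : le n m).
  { apply M4; auto; [apply le_tr with a|apply le_tr with b]; auto. }
  pose proof (rank_mono j u J1 Hu Lj). pose proof (rank_mono n m N1 M1 Ln).
  assert (j = u) as <- by (apply rank_strict; auto; lia).
  assert (n = m) as <- by (apply rank_strict; auto; lia).
  split; auto.
Qed.

Lemma Icov_join p q x y u : P p -> P q -> P x -> P y -> le x p -> le y q ->
  le (meet p q) x -> is_join x y u -> Icov T P le p q u.
Proof.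
  intros Hp Hq Hx Hy Lx Ly Lm (U1 & U2 & U3 & U4).
  pose proof (smeet_spec u p U1 Hp) as A. pose proof (smeet_spec u q U1 Hq) as B.
  pose proof (smeet_spec p q Hp Hq) as M.
  set (a := meet u p) in *; set (b := meet u q) in *; set (m := meet p q) in *.
  split; auto; unfold ginterval.
  pose proof (gdist_rank p q m Hp Hq M).
  pose proof (gdist_rank p u a Hp U1 (meet_comm _ _ _ A)).
  pose proof (gdist_rank u q b U1 Hq B).
  destruct A as (A1 & A2 & A3 & A4), B as (B1 & B2 & B3 & B4), M as (M1 & M2 & M3 & M4).
  assert (le m u) by (apply le_tr with x; auto).
  assert (N : is_meet a b m).
  { repeat split; auto. intros w W1 W2 W3; apply M4; auto;
      [apply le_tr with a|apply le_tr with b]; auto. }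
  assert (J : is_join a b u).
  { repeat split; auto. intros w W1 W2 W3; apply U4; auto;
      [apply le_tr with a|apply le_tr with b]; auto. }
  pose proof (rank_meet_join _ _ _ _ A1 B1 N J). lia.
Qed.

Lemma rvec_rank p q u : P p -> P q -> P u ->
  rvec T P le p q u =
  (INR (r (meet u p)) - INR (r (meet p q)), INR (r (meet u q)) - INR (r (meet p q))).
Proof.
  intros Hp Hq Hu; unfold rvec.
  rewrite !srank_rank; auto; apply smeet_spec; auto.
Qed.

Lemma conv_midpoint (S : R * R -> Prop) a b : S a -> S b ->
  conv S ((fst a + fst b) / 2, (snd a + snd b) / 2).
Proof.
  intros Ha Hb; exists ((1/2, a) :: (1/2, b) :: nil); repeat split.
  - discriminate.
  - destruct H as [E|[E|[]]]; injection E; intros; subst; lra.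
  - destruct H as [E|[E|[]]]; injection E; intros; subst; auto.
  - simpl; lra.
  - simpl; f_equal; lra.
Qed.

Lemma conv_point (S : R * R -> Prop) a : S a -> conv S a.
Proof.
  intros Ha; exists ((1, a) :: nil); repeat split.
  - discriminate.
  - destruct H as [E|[]]; injection E; intros; subst; lra.
  - destruct H as [E|[]]; injection E; intros; subst; auto.
  - simpl; lra.
  - destruct a; simpl; f_equal; lra.
Qed.

(** The join [w] exists by the triple condition: [x] and [b] are bounded by [u], [x] and [b'] by
    [u'], and [b] and [b'] by [q]. *)
Lemma exchange_exists p q m a b a' b' u u' : P p -> P q -> is_meet p q m ->
  P a -> P a' -> P b -> P b' -> P u -> P u' ->
  le a p -> le b q -> le a' p -> le b' q ->
  le m a -> le m a' -> le a u -> le b u -> le a' u' -> le b' u' ->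
  exists x y w, is_meet a a' x /\ is_join b b' y /\ is_join x y w /\
    le x p /\ le y q /\ le m x.
Proof.
  intros Hp Hq M Pa Pa' Pb Pb' Pu Pu' Hap Hbq Ha'p Hb'q Hma Hma' Hau Hbu Ha'u Hb'u.
  destruct (meet_exists a a' Pa Pa') as [x X].
  destruct (join_exists b b' q Pb Pb' Hq) as [y Y]; auto.
  pose proof X as (X1 & X2 & X3 & X4). pose proof Y as (Y1 & Y2 & Y3 & Y4).
  assert (le x u /\ le x u') as [? ?]
    by (split; [apply le_tr with a|apply le_tr with a']; auto).
  destruct (triple_join x b b' u u' q) as (t & T1 & T2 & T3 & T4); auto.
  destruct (join_exists x y t) as [w W]; auto.
  pose proof (proj1 M).
  exists x, y, w; split; [|split; [|split; [|split; [|split]]]]; auto.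
  apply le_tr with a; auto.
Qed.

(* Exchanging [(a, b), (a', b')] for [(a /\ a', b \/ b'), (a \/ a', b /\ b')] does not
   decrease the total of the rank vectors, so extremality forces equality. *)
Lemma rvec_inj p q u u' : P p -> P q -> Eset T P le p q u -> Eset T P le p q u' ->
  rvec T P le p q u = rvec T P le p q u' -> u = u'.
Proof.
  intros Hp Hq (I & X0 & C) (I' & _ & _) E.
  destruct (Icov_spec p q u Hp Hq I) as [J M].
  destruct (Icov_spec p q u' Hp Hq I') as [J' M'].
  pose proof (proj1 I) as Hu. pose proof (proj1 I') as Hu'.
  pose proof (smeet_spec u p Hu Hp) as A. pose proof (smeet_spec u q Hu Hq) as B.
  pose proof (smeet_spec u' p Hu' Hp) as A'. pose proof (smeet_spec u' q Hu' Hq) as B'.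
  pose proof (smeet_spec p q Hp Hq) as Mm.
  rewrite !rvec_rank in E; auto. injection E; intros E2 E1.
  assert (R1 : r (meet u p) = r (meet u' p)) by (apply INR_eq; lra).
  assert (R2 : r (meet u q) = r (meet u' q)) by (apply INR_eq; lra). clear E E1 E2.
  set (a := meet u p) in *; set (b := meet u q) in *; set (m := meet p q) in *.
  set (a' := meet u' p) in *; set (b' := meet u' q) in *.
  destruct A as (A1 & A2 & A3 & A4), B as (B1 & B2 & B3 & B4).
  destruct A' as (A1' & A2' & A3' & A4'), B' as (B1' & B2' & B3' & B4').
  destruct M as (M1 & M2 & M3 & M4), M' as (_ & M2' & M3' & _).
  destruct (exchange_exists p q m a b a' b' u u') as (x & y & w & X & Y & W & Lx & Ly & Lm); auto.
  destruct (exchange_exists q p m b a b' a' u u') 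
    as (y2 & x2 & w2 & Y2 & X2 & W2 & Ly2 & Lx2 & Lm2);
    auto using meet_comm.
  assert (K : Icov T P le p q w) by (apply (Icov_join p q x y); auto; apply X || apply Y).
  assert (K2 : Icov T P le p q w2).
  { apply (Icov_join p q x2 y2); auto; try apply X2; try apply Y2.
    - apply le_tr with a; auto; apply X2.
    - destruct W2 as (? & ? & ? & ?); repeat split; auto. }
  pose proof (proj1 K) as Hw. pose proof (proj1 K2) as Hw2.
  assert (G : forall v s o, P v -> P o -> P s -> le s v -> le s o -> (r s <= r (meet v o))%nat).
  { intros v s o Pv Po Ps L1 L2; pose proof (smeet_spec v o Pv Po) as (S1 & S2 & S3 & S4).
    apply rank_mono; auto. }
  assert (G1 := le_INR _ _ (G w x p Hw Hp (proj1 X) (proj1 (proj2 W)) Lx)).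
  assert (G2 := le_INR _ _ (G w y q Hw Hq (proj1 Y) (proj1 (proj2 (proj2 W))) Ly)).
  assert (G3 := le_INR _ _ (G w2 x2 p Hw2 Hp (proj1 X2) (proj1 (proj2 (proj2 W2))) Lx2)).
  assert (G4 := le_INR _ _ (G w2 y2 q Hw2 Hq (proj1 Y2) (proj1 (proj2 W2)) Ly2)).
  pose proof (rank_meet_join _ _ _ _ A1 A1' X X2) as S1.
  pose proof (rank_meet_join _ _ _ _ B1 B1' Y2 Y) as S2.
  assert (S1' := f_equal INR S1). assert (S2' := f_equal INR S2).
  rewrite !plus_INR in S1', S2'. rewrite <- R1 in S1'. rewrite <- R2 in S2'.
  assert (Q : conv (rpoints T P le p q)
    ((fst (rvec T P le p q w) + fst (rvec T P le p q w2)) / 2,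
     (snd (rvec T P le p q w) + snd (rvec T P le p q w2)) / 2)).
  { apply conv_midpoint; [exists w|exists w2]; auto. }
  set (v1 := rvec T P le p q w) in *. set (v2 := rvec T P le p q w2) in *.
  set (v := rvec T P le p q u) in *.
  assert (Ev1 : v1 = (INR (r (meet w p)) - INR (r m), INR (r (meet w q)) - INR (r m)))
    by (apply rvec_rank; auto).
  assert (Ev2 : v2 = (INR (r (meet w2 p)) - INR (r m), INR (r (meet w2 q)) - INR (r m)))
    by (apply rvec_rank; auto).
  assert (Ev : v = (INR (r a) - INR (r m), INR (r b) - INR (r m)))
    by (apply rvec_rank; auto).
  assert (Z : ((fst v1 + fst v2) / 2, (snd v1 + snd v2) / 2) = v).
  { apply (proj2 C _ Q); rewrite Ev1, Ev2, Ev; simpl; lra. }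
  assert (F : v1 = v2).
  { apply (proj2 X0) with (1 / 2); [| |lra|rewrite <- Z; f_equal; lra].
    - apply conv_point; exists w; auto.
    - apply conv_point; exists w2; auto. }
  rewrite <- F, Ev1, Ev in Z; simpl in Z; injection Z; intros Z2 Z1.
  rewrite <- F, Ev1 in Ev2; injection Ev2; intros Y1 Y0.
  (* Now [w] and [w2] have the rank vector of [u], so the joins [x2] of [a], [a'] and [y] of [b],
     [b'] have ranks no larger than [a] and [b]. Hence [a = a'] and [b = b'], and [u], [u'] are
     joins of the same pair. *)
  assert (R3 : (r x2 <= r a)%nat) by (apply INR_le; lra).
  assert (R4 : (r y <= r b)%nat) by (apply INR_le; lra).
  destruct X2 as (? & ? & ? & ?), Y as (? & ? & ? & ?).
  assert (a = x2) by (apply rank_strict; auto).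
  assert (b = y) by (apply rank_strict; auto).
  assert (a' = a) by (apply rank_strict; auto; [congruence|lia]).
  assert (b' = b) by (apply rank_strict; auto; [congruence|lia]).
  replace a' with a in J' by auto. replace b' with b in J' by auto.
  destruct J as (? & ? & ? & ?), J' as (? & ? & ? & ?); apply le_asym; auto.
Qed.

End Semilattice.

(** * The cones tile the quadrant *)

Lemma avoid_list (D : list R) : forall x y, x < y -> exists t, x < t < y /\ ~ In t D.
Proof.
  induction D as [|a D IH]; intros x y H.
  - exists ((x + y) / 2); split; [lra|auto].
  - destruct (IH x y H) as (t & Ht & N). destruct (Req_dec a t) as [->|E].
    + destruct (IH t y) as (t' & Ht' & N'); [lra|].
      exists t'; split; [lra|]. intros [E|I]; [lra|auto].
    + exists t; split; auto. intros [F|I]; auto.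
Qed.

Lemma lower_gap {U : Type} (lo : U -> R) x l : x < 1 -> (forall u, In u l -> x < lo u) ->
  exists y, x < y <= 1 /\ forall u, In u l -> y <= lo u.
Proof.
  intros Hx; induction l as [|u l IH]; intros H.
  - exists 1; split; [lra|intros ? []].
  - destruct IH as (y & Hy & Hl); [intros; apply H; right; auto|].
    pose proof (H u (or_introl eq_refl)).
    exists (Rmin y (lo u)); split.
    + split; [apply Rmin_glb_lt; lra|]. pose proof (Rmin_l y (lo u)); lra.
    + intros v [<-|I]; [apply Rmin_r|]. pose proof (Rmin_l y (lo u)). specialize (Hl v I); lra.
Qed.

Definition rsum {U : Type} (f : U -> R) (l : list U) : R :=
  fold_right (fun u acc => f u + acc) 0 l.

Lemma rsum_app {U : Type} (f : U -> R) l1 l2 : rsum f (l1 ++ l2) = rsum f l1 + rsum f l2.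
Proof. induction l1 as [|u l1 IH]; simpl; unfold rsum in *; simpl; [lra|rewrite IH; lra]. Qed.

(** Some interval starts exactly at [x]: otherwise [lower_gap] leaves a gap after [x], and a point
    of it outside [D] is uncovered. That interval is removed and the rest tiles from its right end
    on. *)
Lemma tiling_length {U : Type} (lo hi : U -> R) n : forall (l : list U) (D : list R) x,
  length l = n -> x <= 1 -> NoDup l ->
  (forall u, In u l -> x <= lo u < hi u /\ hi u <= 1) ->
  (forall u v, In u l -> In v l -> u <> v -> hi u <= lo v \/ hi v <= lo u) ->
  (forall t, x <= t <= 1 -> ~ In t D -> exists u, In u l /\ lo u <= t <= hi u) ->
  rsum (fun u => hi u - lo u) l = 1 - x.
Proof.
  induction n as [|n IH]; intros l D x En Hx ND B O C.
  - destruct l; [|discriminate]. simpl. destruct (Rlt_dec x 1) as [L|L]; [|lra].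
    destruct (avoid_list D x 1 L) as (t & Ht & N). destruct (C t) as (u & [] & _); auto; lra.
  - assert (L : x < 1).
    { destruct l as [|u l]; [discriminate|].
      destruct (B u (or_introl eq_refl)); lra. }
    assert (exists u, In u l /\ lo u = x) as (u & I & E).
    { apply NNPP; intros F. destruct (lower_gap lo x l L) as (y & Hy & G).
      - intros u I; destruct (B u I) as [[[?|?] ?] ?]; auto.
        exfalso; apply F; eauto.
      - destruct (avoid_list D x y) as (t & Ht & N); [lra|].
        destruct (C t) as (u & I & Hu); auto; [lra|]. specialize (G u I); lra. }
    destruct (in_split _ _ I) as (l1 & l2 & ->).
    rewrite rsum_app; unfold rsum at 2; simpl; fold (rsum (fun u => hi u - lo u) l2).
    rewrite length_app in En; simpl in En.
    pose proof (NoDup_remove_1 _ _ _ ND). pose proof (NoDup_remove_2 _ _ _ ND) as N2.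
    assert (Sub : forall v, In v (l1 ++ l2) -> In v (l1 ++ u :: l2) /\ v <> u).
    { intros v V; split; [|intros ->; auto].
      apply in_app_or in V; apply in_or_app; simpl; tauto. }
    destruct (B u I) as [B1 B2].
    assert (rsum (fun u => hi u - lo u) l1 + rsum (fun u => hi u - lo u) l2 = 1 - hi u).
    (* The point [hi u] may have been covered by [u] alone, so it joins the exceptional set. *)
    { rewrite <- rsum_app. apply (IH (l1 ++ l2) (hi u :: D) (hi u)); auto.
      - rewrite length_app; lia.
      - intros v V; destruct (Sub v V) as [V1 V2]; destruct (B v V1).
        destruct (O u v I V1); auto; lra.
      - intros v w V W N; destruct (Sub v V), (Sub w W); auto.
      - intros t Ht N. destruct (C t) as (v & V & Hv); [lra|intros Q; apply N; right; auto|].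
        exists v; split; auto. apply in_app_or in V; apply in_or_app.
        destruct V as [V|[<-|V]]; auto. exfalso; apply N; left; lra. }
    lra.
Qed.

Lemma affine_interval (L : list (R * R)) :
  (forall t, 0 <= t <= 1 -> ~ (forall ab, In ab L -> 0 <= fst ab + snd ab * t)) \/
  exists lo hi, 0 <= lo <= hi /\ hi <= 1 /\ forall t, 0 <= t <= 1 ->
    ((forall ab, In ab L -> 0 <= fst ab + snd ab * t) <-> lo <= t <= hi).
Proof.
  induction L as [|[a b] L IH].
  - right; exists 0, 1; split; [lra|split; [lra|]]. intros t Ht; split; auto. intros _ ab [].
  - destruct IH as [N|(lo & hi & H1 & H2 & H3)].
    { left; intros t Ht H; apply (N t Ht); intros; apply H; right; auto. }
    assert (G : forall t, 0 <= t <= 1 ->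
      ((forall ab, In ab ((a, b) :: L) -> 0 <= fst ab + snd ab * t) <->
       (0 <= a + b * t /\ lo <= t <= hi))).
    { intros t Ht; rewrite <- H3; auto; split.
      - intros H; split; [apply (H (a, b)); left; auto|intros; apply H; right; auto].
      - intros [Ha Hl] ab [<-|I]; auto. }
    assert (K : (forall t, 0 <= a + b * t -> ~ lo <= t <= hi) \/
      exists lo' hi', lo <= lo' <= hi' /\ hi' <= hi /\
        forall t, (0 <= a + b * t /\ lo <= t <= hi) <-> lo' <= t <= hi').
    { destruct (Rtotal_order b 0) as [Hb|[->|Hb]].
      - assert (Q : forall t, 0 <= a + b * t <-> t <= a / - b).
        { intros t; assert (a = (a / - b) * - b) as E by (field; lra). split; intros; [|nra].
          apply Rmult_le_reg_r with (- b); lra. }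
        destruct (Rle_dec lo (a / - b)).
        + right; exists lo, (Rmin hi (a / - b)).
          split; [split; [lra|apply Rmin_glb; lra]|split; [apply Rmin_l|]].
          intros t; rewrite Q. pose proof (Rmin_l hi (a / - b)). pose proof (Rmin_r hi (a / - b)).
          split; [intros; split; [lra|apply Rmin_glb; lra]|lra].
        + left; intros t; rewrite Q; lra.
      - destruct (Rle_dec 0 a).
        + right; exists lo, hi; split; [lra|split; [lra|intros; split; intros; lra]].
        + left; intros; lra.
      - assert (Q : forall t, 0 <= a + b * t <-> - a / b <= t).
        { intros t; assert (- a = (- a / b) * b) as E by (field; lra). split; intros; [|nra].
          apply Rmult_le_reg_r with b; lra. }
        destruct (Rle_dec (- a / b) hi).
        + right; exists (Rmax lo (- a / b)), hi.
          split; [split; [apply Rmax_l|apply Rmax_lub; lra]|split; [lra|]].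
          intros t; rewrite Q. pose proof (Rmax_l lo (- a / b)). pose proof (Rmax_r lo (- a / b)).
          split; [intros; split; [apply Rmax_lub; lra|lra]|lra].
        + left; intros t; rewrite Q; lra. }
    destruct K as [K|(lo' & hi' & K1 & K2 & K3)].
    + left; intros t Ht H; apply G in H; auto. apply (K t); tauto.
    + right; exists lo', hi'; split; [lra|split; [lra|]].
      intros t Ht; rewrite G; auto.
Qed.

(** The ray at angle [a] meets the segment of points [(1 - t, t)] at [t = slope a]. The coefficient
    of a cone is therefore the length of its trace on that segment. *)
Definition slope (a : R) : R := sin a / (sin a + cos a).

Lemma sin_cos_quadrant a : 0 <= a <= PI / 2 -> 0 <= sin a /\ 0 <= cos a /\ 0 < sin a + cos a.
Proof.
  intros H; pose proof PI_RGT_0.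
  assert (0 <= sin a) by (apply sin_ge_0; lra).
  assert (0 <= cos a) by (apply cos_ge_0; lra).
  pose proof (sin2_cos2 a) as E; unfold Rsqr in E. repeat split; auto; nra.
Qed.

Lemma slope_bounds a : 0 <= a <= PI / 2 -> 0 <= slope a <= 1.
Proof.
  intros H; destruct (sin_cos_quadrant a H) as (S & C & D); unfold slope; split.
  - apply Rle_mult_inv_pos; lra.
  - apply Rmult_le_reg_r with (sin a + cos a); auto. field_simplify; lra.
Qed.

Lemma slope_lt a b : 0 <= a -> a < b -> b <= PI / 2 -> slope a < slope b.
Proof.
  intros Ha Hab Hb; pose proof PI_RGT_0.
  destruct (sin_cos_quadrant a) as (S & C & D); [lra|].
  destruct (sin_cos_quadrant b) as (S' & C' & D'); [lra|].
  assert (0 < sin (b - a)) as P by (apply sin_gt_0; lra). rewrite sin_minus in P.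
  unfold slope; apply Rmult_lt_reg_r with ((sin a + cos a) * (sin b + cos b)).
  - apply Rmult_lt_0_compat; auto.
  - replace (sin a / (sin a + cos a) * ((sin a + cos a) * (sin b + cos b)))
      with (sin a * (sin b + cos b)) by (field; lra).
    replace (sin b / (sin b + cos b) * ((sin a + cos a) * (sin b + cos b)))
      with (sin b * (sin a + cos a)) by (field; lra). lra.
Qed.

Lemma slope_surj h : 0 <= h <= 1 -> exists a, 0 <= a <= PI / 2 /\ slope a = h.
Proof.
  intros H; pose proof PI_RGT_0; unfold slope. destruct (Req_dec h 1) as [->|N].
  - exists (PI / 2); rewrite sin_PI2, cos_PI2; split; [lra|field].
  (* The ray through [(1 - h, h)] has tangent [h / (1 - h)]; the vertical ray has been split off. *)
  - assert (0 <= h / (1 - h)) as Q by (apply Rle_mult_inv_pos; lra).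
    exists (atan (h / (1 - h))); split.
    + pose proof (atan_bound (h / (1 - h))). split; [|lra].
      destruct Q as [Q|<-]; [|rewrite atan_0; lra].
      pose proof (atan_increasing _ _ Q) as I; rewrite atan_0 in I; lra.
    + rewrite sin_atan, cos_atan.
      assert (0 < sqrt (1 + Rsqr (h / (1 - h)))).
      { apply sqrt_lt_R0. pose proof (Rle_0_sqr (h / (1 - h))); lra. }
      field; repeat split; try lra.
Qed.

(* For [w = (1 - t, t)], the angular bound [a] becomes [t <= slope a]. *)
Lemma slope_cone a w1 w2 : 0 <= a <= PI / 2 -> 0 < w1 + w2 ->
  (w2 * cos a <= w1 * sin a <-> w2 / (w1 + w2) <= slope a) /\
  (w2 * cos a >= w1 * sin a <-> slope a <= w2 / (w1 + w2)).
Proof.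
  intros H W; destruct (sin_cos_quadrant a H) as (S & C & D).
  set (t := w2 / (w1 + w2)).
  assert (Et : w2 = t * (w1 + w2)) by (unfold t; field; lra).
  assert (Es : sin a = slope a * (sin a + cos a)) by (unfold slope; field; lra).
  set (s := slope a) in *.
  assert (E : w2 * cos a - w1 * sin a = (t - s) * ((w1 + w2) * (sin a + cos a))).
  { replace ((t - s) * ((w1 + w2) * (sin a + cos a))) with
      ((t * (w1 + w2)) * (sin a + cos a) - (w1 + w2) * (s * (sin a + cos a))) by ring.
    rewrite <- Et, <- Es; ring. }
  assert (0 < (w1 + w2) * (sin a + cos a)) by (apply Rmult_lt_0_compat; auto).
  split; split; intros; nra.
Qed.

(** * Cones traced on the segment, and the sum of their coefficients *)

Section Fan.
Context {T : Type} (P : T -> Prop) (le : T -> T -> Prop) (p q : T).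

Local Notation cone := (Ccone T P le p q).
Local Notation rv := (rvec T P le p q).
Local Notation K := (conv (rpoints T P le p q)).

Lemma conv_dot (S : R * R -> Prop) w M z :
  (forall s, S s -> dot w s <= M) -> conv S z -> dot w z <= M.
Proof.
  intros H (l & _ & A & E & ->).
  assert (G : forall l, (forall w x, In (w, x) l -> 0 <= w /\ S x) ->
    dot w (fold_right (fun wx acc => fst wx * fst (snd wx) + acc) 0 l,
           fold_right (fun wx acc => fst wx * snd (snd wx) + acc) 0 l) <=
    M * fold_right (fun wx acc => fst wx + acc) 0 l).
  { clear l A E; induction l as [|[c x] l IH]; intros A; unfold dot in *; simpl in *; [lra|].
    destruct (A c x (or_introl eq_refl)) as [Hc Hx].
    specialize (IH (fun w x I => A w x (or_intror I))). specialize (H x Hx). nra. }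
  specialize (G l A). rewrite E in G. lra.
Qed.

Lemma cone_scale u k w1 w2 : 0 < k -> cone u (k * w1, k * w2) <-> cone u (w1, w2).
Proof.
  intros Hk; unfold Ccone, dot; simpl; split; intros (H1 & H2 & H3); repeat split; try nra;
    intros z Z; specialize (H3 z Z); nra.
Qed.

(** The trace of the cone of [u] is the interval from [lo] to [hi]. This replaces the two angles,
    and every nonzero direction of the quadrant reduces to it by scaling. *)
Definition cone_slopes u lo hi := 0 <= lo <= hi /\ hi <= 1 /\
  forall t, 0 <= t <= 1 -> (cone u (1 - t, t) <-> lo <= t <= hi).

Lemma Ccoef_slopes u c : Ccoef T P le p q u c -> exists lo hi, cone_slopes u lo hi /\ c = hi - lo.
Proof.
  intros (a & b & Hb & Hab & Ha & H & ->). pose proof PI_RGT_0.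
  exists (slope b), (slope a); split; auto.
  pose proof (slope_bounds a ltac:(lra)). pose proof (slope_bounds b ltac:(lra)).
  split; [split; [lra|]|split; [lra|]].
  { destruct Hab as [Hab|<-]; [|lra]. pose proof (slope_lt b a Hb Hab Ha); lra. }
  intros t Ht. destruct (slope_cone a (1 - t) t) as [Ca _]; [lra|lra|].
  destruct (slope_cone b (1 - t) t) as [_ Cb]; [lra|lra|].
  replace (t / (1 - t + t)) with t in Ca, Cb by (field; lra).
  rewrite H; simpl; rewrite Ca, Cb. lra.
Qed.

Lemma slopes_Ccoef u lo hi : cone_slopes u lo hi -> Ccoef T P le p q u (hi - lo).
Proof.
  intros (H1 & H2 & H). pose proof PI_RGT_0.
  destruct (slope_surj hi) as (a & Ha & Ea); [lra|].
  destruct (slope_surj lo) as (b & Hb & Eb); [lra|].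
  exists a, b; split; [lra|split; [|split; [lra|split]]].
  - destruct (Rle_dec b a); auto. pose proof (slope_lt a b); lra.
  - intros [w1 w2]; simpl.
    assert (G : 0 <= w1 -> 0 <= w2 -> (cone u (w1, w2) <->
      w2 * cos a <= w1 * sin a /\ w2 * cos b >= w1 * sin b)).
    { intros W1 W2. destruct (Req_dec (w1 + w2) 0) as [Z|Z].
      - assert (w1 = 0) as -> by lra. assert (w2 = 0) as -> by lra.
        unfold Ccone, dot; simpl; split; [intros; lra|].
        intros _; repeat split; lra || (intros; lra).
      - assert (W : 0 < w1 + w2) by lra.
        destruct (slope_cone a w1 w2 Ha W) as [Ca _].
        destruct (slope_cone b w1 w2 Hb W) as [_ Cb].
        rewrite Ca, Cb, Ea, Eb.
        assert (0 <= w2 / (w1 + w2) <= 1).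
        { split; [apply Rle_mult_inv_pos; lra|].
          apply Rmult_le_reg_r with (w1 + w2); auto. field_simplify; lra. }
        rewrite <- (cone_scale u (/ (w1 + w2))); [|apply Rinv_0_lt_compat; auto].
        replace (/ (w1 + w2) * w1) with (1 - w2 / (w1 + w2)) by (field; lra).
        replace (/ (w1 + w2) * w2) with (w2 / (w1 + w2)) by (field; lra).
        rewrite H; auto. tauto. }
    split.
    + intros C; assert (0 <= w1 /\ 0 <= w2) as [? ?] by (destruct C as (? & ? & _); auto).
      apply G in C; tauto.
    + intros (? & ? & ? & ?); apply G; auto.
  - fold (slope a) (slope b). lra.
Qed.

Lemma Ccoef_bounds u c : Ccoef T P le p q u c -> 0 <= c <= 1.
Proof. intros C; destruct (Ccoef_slopes u c C) as (lo & hi & (? & ? & _) & ->); lra. Qed.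

Lemma cone_slopes_unique u lo hi lo' hi' :
  cone_slopes u lo hi -> cone_slopes u lo' hi' -> lo = lo' /\ hi = hi'.
Proof.
  intros (A & B & C) (A' & B' & C').
  assert (lo' <= lo <= hi') by (apply C', C; lra). assert (lo' <= hi <= hi') by (apply C', C; lra).
  assert (lo <= lo' <= hi) by (apply C, C'; lra). assert (lo <= hi' <= hi) by (apply C, C'; lra).
  lra.
Qed.

Lemma dot_determined t1 t2 x y : t1 < t2 -> dot (1 - t1, t1) x = dot (1 - t1, t1) y ->
  dot (1 - t2, t2) x = dot (1 - t2, t2) y -> x = y.
Proof.
  destruct x as [x1 x2], y as [y1 y2]; unfold dot; simpl; intros H E1 E2.
  assert (A : (t2 - t1) * ((x2 - y2) - (x1 - y1)) = 0) by lra.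
  apply Rmult_integral in A; destruct A as [A|A]; [lra|].
  assert (x2 - y2 = x1 - y1) by lra. f_equal; nra.
Qed.

Lemma conv_rv u : Icov T P le p q u -> K (rv u).
Proof. intros I; apply conv_point; exists u; auto. Qed.

(** Two independent directions are maximal at [rv u], so no proper segment of the hull passes
    through it; an inner direction has both coordinates positive, so nothing dominates it. *)
Lemma nondegenerate_Eset u lo hi : Icov T P le p q u -> cone_slopes u lo hi -> lo < hi ->
  Eset T P le p q u.
Proof.
  intros I (H1 & H2 & H) L. pose proof (conv_rv u I) as Ku.
  assert (M : forall t, lo <= t <= hi -> forall z, K z ->
    dot (1 - t, t) z <= dot (1 - t, t) (rv u)).
  { intros t Ht; apply (H t); lra. }
  split; [auto|split; split; auto].
  - intros a b s Ka Kb Hs E.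
    assert (G : forall t, lo <= t <= hi -> dot (1 - t, t) a = dot (1 - t, t) b).
    { intros t Ht; pose proof (M t Ht a Ka) as Ma; pose proof (M t Ht b Kb) as Mb.
      assert (Q : dot (1 - t, t) (rv u) = s * dot (1 - t, t) a + (1 - s) * dot (1 - t, t) b)
        by (rewrite E; unfold dot; simpl; ring).
      nra. }
    apply (dot_determined lo hi); auto; apply G; lra.
  - intros z Kz Z1 Z2. set (t := (lo + hi) / 2). assert (Ht : lo < t < hi) by (unfold t; lra).
    pose proof (M t ltac:(lra) z Kz) as Mz; unfold dot in Mz; simpl in Mz.
    destruct z as [z1 z2]; rewrite (surjective_pairing (rv u)); simpl in *.
    f_equal; nra.
Qed.

Variable pts : list (R * R).
Hypothesis pts_spec : forall v, In v pts <-> rpoints T P le p q v.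

Lemma cone_pts u t : Icov T P le p q u -> 0 <= t <= 1 ->
  (cone u (1 - t, t) <-> forall s, In s pts -> dot (1 - t, t) s <= dot (1 - t, t) (rv u)).
Proof.
  intros I Ht; split.
  - intros (_ & _ & H) s Hs; apply H, conv_point, pts_spec; auto.
  - intros H; repeat split; simpl; try lra. intros z; apply conv_dot.
    intros s Hs; apply H, pts_spec; auto.
Qed.

Lemma cone_slopes_exist u : Icov T P le p q u ->
  (forall t, 0 <= t <= 1 -> ~ cone u (1 - t, t)) \/ exists lo hi, cone_slopes u lo hi.
Proof.
  intros I.
  set (L := map (fun s => (fst (rv u) - fst s,
                           (snd (rv u) - snd s) - (fst (rv u) - fst s))) pts).
  assert (G : forall t, 0 <= t <= 1 ->
    (cone u (1 - t, t) <-> forall ab, In ab L -> 0 <= fst ab + snd ab * t)).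
  { intros t Ht; rewrite cone_pts; auto; unfold L, dot; simpl; split.
    - intros H ab A; apply in_map_iff in A; destruct A as (s & <- & S).
      specialize (H s S); simpl; lra.
    - intros H s S. specialize (H _ (in_map _ _ _ S)); simpl in H; lra. }
  destruct (affine_interval L) as [N|(lo & hi & H1 & H2 & H3)].
  - left; intros t Ht; rewrite G; auto.
  - right; exists lo, hi; split; [auto|split; auto]. intros t Ht; rewrite G; auto.
Qed.

Lemma list_max {U : Type} (f : U -> R) l : l <> nil ->
  exists u, In u l /\ forall v, In v l -> f v <= f u.
Proof.
  induction l as [|a l IH]; [contradiction|intros _].
  destruct l as [|b l].
  - exists a; split; [left; auto|]. intros v [<-|[]]; lra.
  - destruct IH as (u & I & M); [discriminate|].
    destruct (Rle_dec (f a) (f u)).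
    + exists u; split; [right; auto|]. intros v [<-|V]; auto.
    + exists a; split; [left; auto|]. intros v [<-|V]; [lra|specialize (M v V); lra].
Qed.

(** A cone depends on [u] only through its rank vector, so one exceptional parameter per vector is
    enough, even for infinitely many [u]. The sublist [pts'] is there for the induction. *)
Lemma degenerate_slopes : forall pts', (forall v, In v pts' -> In v pts) ->
  exists D : list R, forall u t, In (rv u) pts' -> Icov T P le p q u -> 0 <= t <= 1 ->
    cone u (1 - t, t) -> ~ In t D -> exists lo hi, cone_slopes u lo hi /\ lo <= t <= hi /\ lo < hi.
Proof.
  induction pts' as [|v pts' IH]; intros Sub.
  - exists nil; intros u t [].
  - destruct IH as [D HD]; [intros; apply Sub; right; auto|].
    destruct (proj1 (pts_spec v) (Sub v (or_introl eq_refl))) as (u0 & I0 & E0).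
    assert (Q : exists d, forall u t, v = rv u -> Icov T P le p q u -> 0 <= t <= 1 ->
      cone u (1 - t, t) -> t <> d ->
      exists lo hi, cone_slopes u lo hi /\ lo <= t <= hi /\ lo < hi).
    { assert (C : forall u, v = rv u -> Icov T P le p q u -> forall w, cone u w <-> cone u0 w).
      { intros u Eu Iu w; unfold Ccone; rewrite <- Eu, <- E0; tauto. }
      destruct (cone_slopes_exist u0 I0) as [N|(lo & hi & S)].
      - exists 0; intros u t Eu Iu Ht Hc _. apply C in Hc; auto. exfalso; eapply N; eauto.
      (* A trace reduced to a point contains only [t = lo]; for a longer trace excluding [lo] is
         harmless. *)
      - exists lo; intros u t Eu Iu Ht Hc Nt. exists lo, hi. pose proof S as (S1 & S2 & S3).
        assert (lo <= t <= hi) by (apply S3; auto; apply (C u); auto).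
        split; [|split; lra]. split; [auto|split; auto]. intros; rewrite C; auto. }
    destruct Q as [e He]. exists (e :: D); intros u t [Eu|Hu] Iu Ht Hc N.
    + apply He; auto. intros ->; apply N; left; auto.
    + apply HD; auto. intros Q; apply N; right; auto.
Qed.

Hypothesis pts_nonempty : pts <> nil.
Hypothesis rv_inj : forall u u', Eset T P le p q u -> Eset T P le p q u' -> rv u = rv u' -> u = u'.

Lemma Ccoef_sum (l : list (T * R)) : NoDup (map fst l) ->
  (forall u, (Eset T P le p q u /\ exists c, Ccoef T P le p q u c /\ c <> 0) <->
             exists c, In (u, c) l) ->
  (forall u c, In (u, c) l -> Ccoef T P le p q u c /\ c <> 0) ->
  rsum snd l = 1.
Proof.
  intros ND HE HC.
  (* The choice is meaningful only where a trace exists, which holds for all [u] listed in [l]. *)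
  set (pr u := epsilon (inhabits (0, 0)) (fun lh => cone_slopes u (fst lh) (snd lh))).
  set (lo u := fst (pr u)). set (hi u := snd (pr u)).
  assert (Spec : forall u a b, cone_slopes u a b -> lo u = a /\ hi u = b).
  { intros u a b S. apply (cone_slopes_unique u); auto. unfold lo, hi, pr.
    apply (epsilon_spec (inhabits (0, 0)) (fun lh => cone_slopes u (fst lh) (snd lh))).
    exists (a, b); auto. }
  assert (In_l : forall u c, In (u, c) l ->
    cone_slopes u (lo u) (hi u) /\ lo u < hi u /\ c = hi u - lo u).
  { intros u c I; destruct (HC u c I) as [C N].
    destruct (Ccoef_slopes u c C) as (a & b & S & ->). destruct (Spec u a b S) as [-> ->].
    split; [auto|split; auto]. destruct S as (? & ? & _); lra. }
  assert (E : rsum snd l = rsum (fun u => hi u - lo u) (map fst l)).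
  { clear - In_l. induction l as [|[u c] l IH]; auto.
    unfold rsum in *; simpl. rewrite IH.
    - destruct (In_l u c (or_introl eq_refl)) as (_ & _ & ->); auto.
    - intros; apply In_l; right; auto. }
  assert (In_map : forall u, In u (map fst l) -> exists c, In (u, c) l).
  { intros u I; apply in_map_iff in I; destruct I as ([u' c] & <- & I); eauto. }
  rewrite E. destruct (degenerate_slopes pts (fun v H => H)) as [D HD].
  replace 1 with (1 - 0) by ring.
  apply (tiling_length lo hi _ _ D 0 eq_refl); auto; try lra.
  - intros u I; destruct (In_map u I) as [c Ic].
    destruct (In_l u c Ic) as ((? & ? & _) & ? & _); lra.
  - intros u v Iu Iv N.
    destruct (In_map u Iu) as [c Ic], (In_map v Iv) as [c' Ic'].
    destruct (In_l u c Ic) as ((U1 & U2 & U3) & U4 & _).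
    destruct (In_l v c' Ic') as ((V1 & V2 & V3) & V4 & _).
    (* Overlapping traces share two directions in which both rank vectors are maximal. Two
       directions determine a vector, and [rv_inj] then identifies the elements. *)
    apply NNPP; intros F. apply N.
    destruct (proj2 (HE u) (ex_intro _ c Ic)) as [Eu _].
    destruct (proj2 (HE v) (ex_intro _ c' Ic')) as [Ev _].
    apply rv_inj; auto.
    assert (G : forall t, lo u <= t <= hi u -> lo v <= t <= hi v ->
      dot (1 - t, t) (rv u) = dot (1 - t, t) (rv v)).
    { intros t Tu Tv. apply Rle_antisym.
      - apply (V3 t); [lra|auto|apply conv_rv, Eu].
      - apply (U3 t); [lra|auto|apply conv_rv, Ev]. }
    pose proof (Rmax_l (lo u) (lo v)). pose proof (Rmax_r (lo u) (lo v)).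
    pose proof (Rmin_l (hi u) (hi v)). pose proof (Rmin_r (hi u) (hi v)).
    assert (Rmax (lo u) (lo v) < Rmin (hi u) (hi v)).
    { apply Rmax_lub_lt; apply Rmin_glb_lt; lra. }
    apply (dot_determined (Rmax (lo u) (lo v)) (Rmin (hi u) (hi v))); auto; apply G; lra.
  (* A rank vector maximal in direction [(1 - t, t)] has that direction in its cone; outside [D] the
     trace has positive length, so the element occurs in [l]. *)
  - intros t Ht N. destruct (list_max (dot (1 - t, t)) pts pts_nonempty) as (s & Is & M).
    destruct (proj1 (pts_spec s) Is) as (u & Iu & ->).
    assert (Hc : cone u (1 - t, t)) by (apply cone_pts; auto).
    destruct (HD u t) as (a & b & S & Hab & L); auto.
    destruct (Spec u a b S) as [Ea Eb].
    exists u; split; [|lra].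
    assert (exists c, In (u, c) l) as [c Ic].
    { apply HE; split; [eapply nondegenerate_Eset; eauto|].
      exists (b - a); split; [apply slopes_Ccoef; auto|lra]. }
    apply (in_map fst) in Ic; auto.
Qed.

Lemma ER_sum_lower (f : T -> ER) (h : T -> R) B base l :
  (forall u c, In (u, c) l -> 0 <= c /\ ER_le (Fin (h u)) (f u)) -> ER_le (Fin B) base ->
  ER_le (Fin (rsum (fun uc => snd uc * h (fst uc)) l + B))
    (fold_right (fun uc acc => ER_add (ER_scale (snd uc) (f (fst uc))) acc) base l).
Proof.
  intros H HB; induction l as [|[u c] l IH]; simpl.
  - destruct base; simpl in *; auto; lra.
  - destruct (H u c (or_introl eq_refl)) as [Hc Hu].
    specialize (IH (fun u c I => H u c (or_intror I))).
    destruct (fold_right _ base l); destruct (f u); simpl in *; auto.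
    unfold rsum in *; simpl in *. nra.
Qed.

Definition coef_at (v : T) (uc : T * R) : R :=
  if excluded_middle_informative (fst uc = v) then snd uc else 0.

Lemma coef_at_sum v (l : list (T * R)) : NoDup (map fst l) ->
  (forall c, In (v, c) l -> c < 1) -> rsum (coef_at v) l < 1.
Proof.
  intros ND H.
  assert (Z : forall l, ~ In v (map fst l) -> rsum (coef_at v) l = 0).
  { clear; induction l as [|[u c] l IH]; auto; intros N; unfold rsum in *; simpl in *.
    rewrite IH; [|tauto]. unfold coef_at; simpl.
    destruct (excluded_middle_informative (u = v)); [tauto|lra]. }
  induction l as [|[u c] l IH]; [unfold rsum; simpl; lra|].
  inversion ND as [|? ? N ND']; subst.
  change (coef_at v (u, c) + rsum (coef_at v) l < 1). unfold coef_at at 1; simpl in *.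
  destruct (excluded_middle_informative (u = v)) as [->|_].
  - rewrite Z; auto. specialize (H c (or_introl eq_refl)); lra.
  - specialize (IH ND' (fun c I => H c (or_intror I))); lra.
Qed.

(** If every other [u] had value at least [B], then with [cp], [cq] the coefficients of [p], [q] and
    total weight 1, submodularity would read [(a - B) * (1 - cp) + (b - B) * (1 - cq) >= 0]. Both
    summands are at most 0, and one is negative since [cp], [cq] are below 1. *)
Lemma submodular_descent (f : T -> ER) (a b B : R) : submodular T P le f -> P p -> P q ->
  Icov T P le p q p -> Icov T P le p q q ->
  fst (rv q) < fst (rv p) -> snd (rv p) < snd (rv q) ->
  f p = Fin a -> f q = Fin b -> a <= B -> b <= B -> a + b < 2 * B ->
  ER_le (Fin B) (f (smeet T P le p q)) ->
  exists u c, Icov T P le p q u /\ u <> p /\ u <> q /\ f u = Fin c /\ c < B.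
Proof.
  intros Hf Hp Hq Ip Iq R1 R2 Ea Eb La Lb Lab HB. apply NNPP; intros F.
  destruct (Hf p q Hp Hq) as (l & ND & HE & HC & S). rewrite Ea, Eb in S; simpl in S.
  set (h u := B + (if excluded_middle_informative (u = p) then a - B else 0) +
                  (if excluded_middle_informative (u = q) then b - B else 0)).
  assert (N : p <> q) by (intros ->; lra).
  assert (H : ER_le (Fin (rsum (fun uc => snd uc * h (fst uc)) l + B)) (Fin (a + b))).
  { pose proof (ER_sum_lower f h B (f (smeet T P le p q)) l) as G.
    destruct (fold_right _ (f (smeet T P le p q)) l) as [M|]; [|contradiction].
    simpl in *; apply Rle_trans with M; auto. apply G; auto.
    intros u c I; destruct (HC u c I) as [C _]. split; [apply (Ccoef_bounds u c C)|].
    unfold h. destruct (excluded_middle_informative (u = p)) as [->|Np].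
    { destruct (excluded_middle_informative (p = q)); [tauto|]. rewrite Ea; lra. }
    destruct (excluded_middle_informative (u = q)) as [->|Nq]; [rewrite Eb; lra|].
    destruct (f u) as [e|] eqn:Eu; auto.
    destruct (Rlt_dec e B); [|lra]. exfalso; apply F.
    exists u, e; repeat split; auto; apply (proj2 (HE u) (ex_intro _ c I)). }
  assert (E : rsum (fun uc => snd uc * h (fst uc)) l =
    B * rsum snd l + (a - B) * rsum (coef_at p) l + (b - B) * rsum (coef_at q) l).
  { clear; unfold rsum; induction l as [|[u c] l IH]; simpl; [ring|]. rewrite IH.
    unfold h, coef_at; simpl.
    destruct (excluded_middle_informative (u = p)), (excluded_middle_informative (u = q)); ring. }
  assert (Sp : rsum (coef_at p) l < 1).
  { apply coef_at_sum; auto. intros c I; destruct (HC p c I) as [C _].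
    pose proof (Ccoef_bounds p c C). destruct (Rlt_dec c 1); auto.
    assert (c = 1) as -> by lra.
    (* Coefficient 1 means that the cone is the whole quadrant; direction [(0, 1)] then contradicts
       [R2]. *)
    destruct (Ccoef_slopes p 1 C) as (lo & hi & (H1 & H2 & H3) & E1).
    destruct (proj2 (H3 1 ltac:(lra)) ltac:(lra)) as (_ & _ & M).
    specialize (M _ (conv_rv q Iq)); unfold dot in M; cbn [fst snd] in M; lra. }
  assert (Sq : rsum (coef_at q) l < 1).
  { apply coef_at_sum; auto. intros c I; destruct (HC q c I) as [C _].
    pose proof (Ccoef_bounds q c C). destruct (Rlt_dec c 1); auto.
    assert (c = 1) as -> by lra.
    destruct (Ccoef_slopes q 1 C) as (lo & hi & (H1 & H2 & H3) & E1).
    destruct (proj2 (H3 0 ltac:(lra)) ltac:(lra)) as (_ & _ & M).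
    specialize (M _ (conv_rv p Ip)); unfold dot in M; cbn [fst snd] in M; lra. }
  rewrite E, (Ccoef_sum l ND HE HC) in H; simpl in H. clear - H Sp Sq La Lb Lab.
  destruct (Rlt_dec a B); nra.
Qed.

End Fan.

Section Descent.
Context {T : Type} (P : T -> Prop) (le : T -> T -> Prop) (r : T -> nat) (bot : T).
Hypothesis MS : modular_semilattice P le r bot.

(** The interval of [p] and [q] may be infinite, but the ranks of the meets with [p] and [q] are
    integers bounded by [r p] and [r q]. *)
Lemma rpoints_finite p q : P p -> P q ->
  exists pts, forall v, In v pts <-> rpoints T P le p q v.
Proof.
  intros Hp Hq.
  set (coords n := map (fun i => INR i - INR (r (smeet T P le p q))) (seq 0 (S n))).
  exists (filter (fun v => if excluded_middle_informative (rpoints T P le p q v)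
                           then true else false) (list_prod (coords (r p)) (coords (r q)))).
  intros v; rewrite filter_In.
  destruct (excluded_middle_informative (rpoints T P le p q v)) as [H|H];
    [|split; [intros [_ E]; discriminate|tauto]].
  split; auto; intros _; split; auto. destruct H as (u & I & ->).
  rewrite (rvec_rank P le r bot MS); auto; [|apply I].
  assert (C : forall o, P o -> In (INR (r (smeet T P le u o)) - INR (r (smeet T P le p q)))
    (coords (r o))).
  { intros o Po. apply (in_map (fun i => INR i - INR (r (smeet T P le p q)))), in_seq.
    destruct (smeet_spec P le r bot MS u o (proj1 I) Po) as (A1 & A2 & A3 & _).
    pose proof (rank_mono P le r bot MS _ o A1 Po A3). lia. }
  apply in_prod; auto.
Qed.

Lemma Icov_endpoints p q : P p -> P q -> Icov T P le p q p /\ Icov T P le p q q.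
Proof.
  intros Hp Hq; split; split; auto; unfold ginterval; rewrite gdist_refl; auto.
Qed.

Lemma semilattice_descent (f : T -> ER) p q (a b B : R) : submodular T P le f -> P p -> P q ->
  ~ le p q -> ~ le q p ->
  f p = Fin a -> f q = Fin b -> a <= B -> b <= B -> a + b < 2 * B ->
  ER_le (Fin B) (f (smeet T P le p q)) ->
  exists u c, Icov T P le p q u /\ u <> p /\ u <> q /\ f u = Fin c /\ c < B.
Proof.
  intros Hf Hp Hq Np Nq.
  destruct (rpoints_finite p q Hp Hq) as [pts Hpts].
  destruct (Icov_endpoints p q Hp Hq) as [Ip Iq].
  pose proof (smeet_spec P le r bot MS p q Hp Hq) as M.
  pose proof (smeet_spec P le r bot MS q p Hq Hp) as M'.
  assert (E : smeet T P le q p = smeet T P le p q).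
  { apply (meet_unique P le r bot MS q p); auto. apply meet_comm; auto. }
  destruct M as (M1 & M2 & M3 & M4).
  assert (S : forall o, P o -> le (smeet T P le p q) o -> ~ (le o p /\ le o q) ->
    (r (smeet T P le p q) < r o)%nat).
  { intros o Po L N. destruct (Compare_dec.le_lt_dec (r o) (r (smeet T P le p q))) as [G|]; auto.
    apply (rank_strict P le r bot MS) in G; auto. exfalso; apply N; rewrite <- G; auto. }
  pose proof (ms_refl _ _ _ _ MS).
  apply (submodular_descent P le p q pts Hpts); auto.
  - intros Q; assert (In (rvec T P le p q p) pts) as I.
    { apply Hpts; exists p; auto. } rewrite Q in I; destruct I.
  - intros u u'; apply (rvec_inj P le r bot MS p q u u' Hp Hq).
  (* The first coordinate vanishes at [q] and is positive at [p], which is not below [q]; the next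
     goal is symmetric. *)
  - rewrite !(rvec_rank P le r bot MS); auto; simpl.
    rewrite E, (smeet_le P le r bot MS p p); auto.
    pose proof (lt_INR _ _ (S p Hp M2 ltac:(tauto))). lra.
  - rewrite !(rvec_rank P le r bot MS); auto; simpl.
    rewrite (smeet_le P le r bot MS q q); auto.
    pose proof (lt_INR _ _ (S q Hq M3 ltac:(tauto))). lra.
Qed.

End Descent.

(** * The semilattice of intervals around a vertex *)

Section Star.
Context {V : Type} (adj arc : V -> V -> Prop).
Hypothesis HG : simple_connected_graph adj.
Hypothesis Hmod : modular_graph adj.
Hypothesis Hor : admissible_orientation adj arc.
Variable z : V.

Local Notation d := (gdist adj).
Local Notation le := (preceq arc).
Local Notation P := (Istar arc z).
Local Notation incl := (incl_order arc).

Let Hflip : admissible_orientation adj (flip_arc arc) :=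
  flip_admissible adj arc (proj1 HG) Hor.
Let dsym := dist_sym adj HG.
Let ladd := preceq_dist adj arc HG Hmod Hor.
Let lantisym := preceq_antisym adj arc HG Hmod Hor.
Let sub := sqsub_interval adj arc HG Hmod Hor.

Definition star_rank (a : V * V) : nat := (d (fst a) z + d z (snd a))%nat.

Lemma incl_iff a b : P a -> (incl a b <-> le (fst b) (fst a) /\ le (snd a) (snd b)).
Proof.
  intros (S & H1 & H2); split.
  - intros I; destruct (I (fst a)); auto using preceq_refl; [apply S|].
    destruct (I (snd a)); auto using preceq_refl; apply S.
  - intros [L1 L2] w W1 W2; split; eauto using preceq_trans.
Qed.

Lemma Istar_sub s t s' t' : P (s, t) -> le s s' -> le s' z -> le z t' -> le t' t -> P (s', t').
Proof.
  intros (S & _ & _) H1 H2 H3 H4; split; [|split]; auto; simpl in *.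
  apply (sub s t); eauto using preceq_trans.
Qed.

Lemma arc_between x y w : arc x y -> le y w -> le w x -> w = y \/ w = x.
Proof.
  intros A H1 H2. apply (proj2 (covers_pre_arc adj arc HG Hmod Hor y x)) in A.
  destruct A as (_ & _ & C); auto.
Qed.

Lemma scovers_arc s t s' t' : P (s, t) -> P (s', t') ->
  (s = s' /\ arc t' t) \/ (t = t' /\ arc s s') -> scovers (V * V) P incl (s, t) (s', t').
Proof.
  intros H H' C. split; [|split; [|split; [|split]]]; auto.
  - apply incl_iff; auto; simpl.
    destruct C as [[-> A]|[-> A]]; split; auto using preceq_refl, arc_le.
  - intros E; injection E; intros; subst.
    destruct C as [[_ A]|[_ A]]; eapply (arc_asym adj arc Hor); eauto.
  - intros [x y] Hx I1 I2. apply incl_iff in I1; auto. apply incl_iff in I2; auto. simpl in *.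
    destruct I1, I2, C as [[<- A]|[<- A]].
    + assert (x = s) as -> by (apply lantisym; auto).
      destruct (arc_between _ _ y A) as [->| ->]; auto.
    + assert (y = t) as -> by (apply lantisym; auto).
      destruct (arc_between _ _ x A) as [->| ->]; auto.
Qed.

Lemma atom_above p e : le p e -> p <> e -> exists a, arc e a /\ le p a.
Proof.
  intros H N. destruct (atom_below adj (flip_arc arc) HG Hmod Hflip e p) as (a & A & L); auto.
  - apply flip_le; auto.
  - exists a; split; auto. apply flip_le; auto.
Qed.

(** The interval [(s', t)] lies between the two, so it equals one of them: a cover moves a single
    end, and by minimality along a single arc. *)
Lemma star_cover a b : scovers (V * V) P incl a b -> star_rank b = S (star_rank a).
Proof.
  destruct a as [s t], b as [s' t']; intros (H & H' & I & N & C); unfold star_rank; simpl.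
  apply incl_iff in I; auto; simpl in I; destruct I as [I1 I2].
  pose proof H as (_ & S1 & T1); pose proof H' as (_ & S2 & T2); simpl in *.
  assert (Hm : P (s', t)) by (apply (Istar_sub s' t'); auto using preceq_refl).
  destruct (C (s', t)) as [E|E]; auto;
    [apply incl_iff; auto using preceq_refl..| |]; injection E; intros; subst.
  - assert (Nt : t <> t') by congruence.
    destruct (atom_below adj arc HG Hmod Hor t t' I2 Nt) as (e & A & L).
    assert (Le : le t e) by (apply arc_le; auto).
    assert (He : P (s, e)) by (apply (Istar_sub s t'); eauto using preceq_refl, preceq_trans).
    assert (e = t') as ->.
    { destruct (C (s, e)) as [E'|E']; auto;
        try (apply incl_iff; auto using preceq_refl); try congruence.
      injection E'; intros ->; exfalso; eapply (arc_asym adj arc Hor); eauto. }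
    rewrite (ladd z t t'), (dsym t t'), (dist_adj adj HG t' t); auto; [lia|].
    apply (arc_adj adj arc Hor); auto.
  - assert (Ns : s' <> s) by congruence.
    destruct (atom_below adj arc HG Hmod Hor s' s I1 Ns) as (e & A & L).
    assert (Le : le s' e) by (apply arc_le; auto).
    assert (He : P (e, t')) by (apply (Istar_sub s' t'); eauto using preceq_refl, preceq_trans).
    assert (e = s) as ->.
    { destruct (C (e, t')) as [E'|E']; auto;
        try (apply incl_iff; auto using preceq_refl); try congruence.
      injection E'; intros ->; exfalso; eapply (arc_asym adj arc Hor); eauto. }
    rewrite (ladd s' s z), (dsym s' s), (dist_adj adj HG s s'); auto.
    apply (arc_adj adj arc Hor); auto.
Qed.

Lemma star_chain n : forall s t s' t', (d s' s + d t t')%nat = n -> P (s, t) -> P (s', t') ->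
  le s' s -> le t t' -> exists n, cov_chain (V * V) P incl (s, t) (s', t') n.
Proof.
  induction n as [n IH] using lt_wf_ind; intros s t s' t' En H H' L1 L2.
  pose proof H as (_ & S1 & T1); pose proof H' as (_ & S2 & T2); simpl in *.
  destruct (classic (s' = s)) as [->|Ns].
  - destruct (classic (t = t')) as [->|Nt]; [exists 0%nat; constructor|].
    destruct (atom_below adj arc HG Hmod Hor t t' L2 Nt) as (e & A & L).
    pose proof (ladd _ _ _ (arc_le _ _ _ A) L) as E.
    rewrite (dsym t e), (dist_adj adj HG e t) in E; [|apply (arc_adj adj arc Hor); auto].
    assert (He : P (s, e))
      by (apply (Istar_sub s t'); auto using preceq_refl;
          apply preceq_trans with t; [auto|apply arc_le; auto]).
    destruct (IH (d s s + d e t')%nat ltac:(lia) s e s t') as [k K]; auto.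
    exists (S k); econstructor; eauto. apply scovers_arc; auto.
  - destruct (atom_above s' s L1 Ns) as (e & A & L).
    pose proof (ladd _ _ _ L (arc_le _ _ _ A)) as E.
    rewrite (dsym e s), (dist_adj adj HG s e) in E; [|apply (arc_adj adj arc Hor); auto].
    assert (He : P (e, t)).
    { apply (Istar_sub s' t'); auto. apply preceq_trans with s; [apply arc_le; auto|auto]. }
    destruct (IH (d s' e + d t t')%nat ltac:(lia) e t s' t') as [k K]; auto.
    exists (S k); econstructor; eauto. apply scovers_arc; auto.
Qed.

Lemma star_meet s t s' t' j m : P (s, t) -> P (s', t') -> lub_of arc s s' j -> glb_of arc t t' m ->
  is_meet P incl (s, t) (s', t') (j, m).
Proof.
  intros H H' J M. pose proof H as (_ & S1 & T1); pose proof H' as (_ & S2 & T2); simpl in *.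
  destruct J as (J1 & J2 & J3), M as (M1 & M2 & M3).
  assert (Hm : P (j, m)) by (apply (Istar_sub s t); auto).
  split; [|split; [|split]]; auto; try (apply incl_iff; auto).
  intros [x y] Hx I1 I2. apply incl_iff in I1, I2; auto. apply incl_iff; auto.
  simpl in *; split; [apply J3|apply M3]; tauto.
Qed.

Lemma star_join s t s' t' u m j : P (s, t) -> P (s', t') -> P u ->
  incl (s, t) u -> incl (s', t') u -> glb_of arc s s' m -> lub_of arc t t' j ->
  is_join P incl (s, t) (s', t') (m, j).
Proof.
  intros H H' Hu I I' M J. destruct u as [a b].
  apply incl_iff in I, I'; auto. simpl in I, I'. destruct I as [I1 I2], I' as [I1' I2'].
  pose proof H as (_ & S1 & T1); pose proof H' as (_ & S2 & T2); simpl in *.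
  destruct J as (J1 & J2 & J3), M as (M1 & M2 & M3).
  assert (Hm : P (m, j)) by (apply (Istar_sub a b); eauto using preceq_trans).
  split; [|split; [|split]]; auto; try (apply incl_iff; auto).
  intros [x y] Hx K K'. apply incl_iff in K, K'; auto. apply incl_iff; auto.
  simpl in *; split; [apply M3|apply J3]; tauto.
Qed.

(** Medians bound the upper and the lower ends separately, but the interval between those bounds
    need not be complemented. The meet [m] of the lower ends and the join [j] of the upper ends do
    work: [m] is in relation [sqsub] to each upper end by [sqsub_glb], hence to [j] by
    [sqsub_lub]. *)
Lemma star_triple x y w a b c : P x -> P y -> P w -> P a -> P b -> P c ->
  incl x a -> incl y a -> incl x b -> incl w b -> incl y c -> incl w c ->
  exists t, P t /\ incl x t /\ incl y t /\ incl w t.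
Proof.
  intros Hx Hy Hw Ha Hb Hc Ixa Iya Ixb Iwb Iyc Iwc.
  apply incl_iff in Ixa, Iya, Ixb, Iwb, Iyc, Iwc; auto.
  destruct x as [sx tx], y as [sy ty], w as [sw tw], a as [sa ta], b as [sb tb], c as [sc tc].
  destruct Hx as (Qx & Sx & Tx), Hy as (Qy & Sy & Ty), Hw as (Qw & Sw & Tw).
  destruct Ha as (Qa & Sa & Ta), Hb as (Qb & Sb & Tb), Hc as (Qc & Sc & Tc).
  simpl in *.
  destruct Ixa, Iya, Ixb, Iwb, Iyc, Iwc.
  destruct (triple_bounded adj arc HG Hmod Hor z tx ty tw ta tb tc) as (T & T1 & T2 & T3); auto.
  destruct (triple_bounded adj (flip_arc arc) HG Hmod Hflip z sx sy sw sa sb sc)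
    as (S & S1 & S2 & S3); try (apply flip_le; auto).
  apply flip_le in S1, S2, S3.
  destruct (glb_exists adj arc HG Hmod Hor sx sy S) as [m1 M1]; auto.
  destruct (glb_exists adj arc HG Hmod Hor m1 sw S) as [m M]; auto; [apply M1; auto|].
  destruct (lub_exists adj arc HG Hmod Hor tx ty T) as [j1 J1]; auto.
  destruct (lub_exists adj arc HG Hmod Hor j1 tw T) as [j J]; auto; [apply J1; auto|].
  pose proof (sqsub_glb adj arc HG Hmod Hor) as G.
  assert (Z : forall s t, le s z -> le z t -> le s t) by eauto using preceq_trans.
  assert (sqsub arc m tx).
  { apply (G m1 sw); auto; [apply (G sx sy); auto|];
      [apply (sub sa ta)|apply (sub sb tb)]; auto. }
  assert (sqsub arc m ty).
  { apply (G m1 sw); auto; [apply (G sx sy); auto|];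
      [apply (sub sa ta)|apply (sub sc tc)]; auto. }
  assert (sqsub arc m tw).
  { apply (G m1 sw); auto. apply (G sx sy); auto;
      [apply (sub sb tb)|apply (sub sc tc)]; auto. }
  pose proof (sqsub_lub adj arc HG Hmod Hor) as L.
  destruct M1 as (? & ? & _), M as (? & ? & _).
  pose proof J1 as (? & ? & _). pose proof J as (? & ? & _).
  assert (Hm : P (m, j)).
  { split; [|split]; simpl.
    - apply (L m j1 tw); auto. apply (L m tx ty); auto.
    - apply preceq_trans with m1; auto. apply preceq_trans with sx; auto.
    - apply preceq_trans with tx; auto. apply preceq_trans with j1; auto. }
  exists (m, j); split; auto.
  split; [|split]; (apply incl_iff; [split; [|split]; auto|simpl; split; eauto using preceq_trans]).
Qed.

Theorem Istar_modular_semilattice : modular_semilattice P incl star_rank (z, z).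
Proof.
  assert (Pz : P (z, z)).
  { split; [|split]; simpl; auto using preceq_refl. apply (sqsub_refl adj arc HG Hmod Hor). }
  split.
  - intros a Ha; apply incl_iff; auto using preceq_refl.
  - intros a b c Ha Hb Hc H1 H2 w W1 W2. destruct (H1 w W1 W2). auto.
  - intros [s t] [s' t'] Ha Hb H1 H2. apply incl_iff in H1, H2; auto; simpl in *.
    f_equal; apply lantisym; tauto.
  - exact Pz.
  - intros a Ha; apply incl_iff; auto; split; apply Ha.
  - unfold star_rank; simpl; rewrite dist_refl; auto.
  - apply star_cover.
  - intros [s t] [s' t'] Ha Hb I. apply incl_iff in I; auto; simpl in I.
    eapply star_chain; eauto; tauto.
  - intros [s t] [s' t'] Ha Hb. pose proof Ha as (_ & S1 & T1); pose proof Hb as (_ & S2 & T2).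
    destruct (lub_exists adj arc HG Hmod Hor s s' z S1 S2) as [j J].
    destruct (glb_exists adj arc HG Hmod Hor t t' z T1 T2) as [m M].
    exists (j, m); apply star_meet; auto.
  - intros [s t] [s' t'] u Ha Hb Hu I I'.
    pose proof (proj1 (incl_iff _ _ Ha) I) as [I1 I2].
    pose proof (proj1 (incl_iff _ _ Hb) I') as [I1' I2']. simpl in *.
    destruct (glb_exists adj arc HG Hmod Hor s s' _ I1 I1') as [m M].
    destruct (lub_exists adj arc HG Hmod Hor t t' _ I2 I2') as [j J].
    exists (m, j); apply (star_join s t s' t' u); auto.
  (* Uniqueness identifies the given meet and join with those formed from the ends; the identity
     then splits into [rank_modular] for the upper ends and its dual for the lower ends. *)
  - intros [s t] [s' t'] [j m] [m' j'] Ha Hb M J. unfold star_rank; simpl.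
    pose proof Ha as (_ & S1 & T1); pose proof Hb as (_ & S2 & T2); simpl in *.
    pose proof J as (J0 & J1 & J2 & J3). pose proof M as (M0 & _ & _ & M3).
    pose proof (proj1 (incl_iff _ _ Ha) J1) as [I1 I2].
    pose proof (proj1 (incl_iff _ _ Hb) J2) as [I1' I2']. simpl in *.
    destruct (lub_exists adj arc HG Hmod Hor s s' z S1 S2) as [x X].
    destruct (glb_exists adj arc HG Hmod Hor t t' z T1 T2) as [y Y].
    destruct (glb_exists adj arc HG Hmod Hor s s' _ I1 I1') as [x' X'].
    destruct (lub_exists adj arc HG Hmod Hor t t' _ I2 I2') as [y' Y'].
    pose proof (star_meet _ _ _ _ _ _ Ha Hb X Y) as (A1 & A2 & A3 & A4).
    pose proof (star_join _ _ _ _ _ _ _ Ha Hb J0 J1 J2 X' Y') as (B1 & B2 & B3 & B4).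
    assert (U1 : incl (j, m) (x, y)) by (apply A4; apply M).
    assert (U2 : incl (x, y) (j, m)) by (apply M3; auto).
    assert (U3 : incl (m', j') (x', y')) by (apply J3; auto).
    assert (U4 : incl (x', y') (m', j')) by (apply B4; auto).
    apply incl_iff in U1, U2, U3, U4; auto. simpl in *.
    assert (j = x) as <- by (apply lantisym; tauto).
    assert (m = y) as <- by (apply lantisym; tauto).
    assert (m' = x') as <- by (apply lantisym; tauto).
    assert (j' = y') as <- by (apply lantisym; tauto).
    pose proof (rank_modular adj arc HG Hmod Hor z t t' m j' T1 T2 Y Y').
    pose proof (rank_modular adj (flip_arc arc) HG Hmod Hflip z s s' j m').
    rewrite !flip_le, flip_glb, flip_lub in *. specialize (H0 S1 S2 X X').
    rewrite (dsym s z), (dsym s' z), (dsym j z), (dsym m' z). lia.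
  - apply star_triple.
Qed.

End Star.

(** * Detours around a vertex *)

Section Reroute.
Context {V : Type} (adj arc : V -> V -> Prop) (g : V -> ER).
Hypothesis HG : simple_connected_graph adj.
Hypothesis Hmod : modular_graph adj.
Hypothesis Hor : admissible_orientation adj arc.

Local Notation d := (gdist adj).
Local Notation le := (preceq arc).

Let dsym := dist_sym adj HG.
Let dtri := dist_tri adj HG.
Let ladd := preceq_dist adj arc HG Hmod Hor.
Let lantisym := preceq_antisym adj arc HG Hmod Hor.
Let sub := sqsub_interval adj arc HG Hmod Hor.

Definition sstep a b := sqsub arc a b \/ sqsub arc b a.

(* The number records the total graph distance covered, and [Q] constrains the
   interior vertices only. *)
Inductive spath (Q : V -> Prop) : V -> V -> nat -> Prop :=
| spath_step a b : sstep a b -> spath Q a b (d a b)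
| spath_cons a c b n : sstep a c -> Q c -> spath Q c b n -> spath Q a b (d a c + n).

Lemma sstep_sym a b : sstep a b -> sstep b a.
Proof. unfold sstep; tauto. Qed.

Lemma spath_app Q a c b m n : spath Q a c m -> Q c -> spath Q c b n -> spath Q a b (m + n).
Proof.
  intros H Hc K; induction H as [a c S|a e c m S He H IH].
  - apply spath_cons; auto.
  - rewrite <- Nat.add_assoc; apply spath_cons; auto.
Qed.

Lemma spath_rev Q a b n : spath Q a b n -> spath Q b a n.
Proof.
  induction 1 as [a b S|a c b n S Hc H IH].
  - rewrite dsym; apply spath_step, sstep_sym; auto.
  - rewrite Nat.add_comm, dsym. apply spath_app with c; auto. apply spath_step, sstep_sym; auto.
Qed.

Lemma spath_mono (Q Q' : V -> Prop) a b n : (forall v, Q v -> Q' v) ->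
  spath Q a b n -> spath Q' a b n.
Proof. intros H; induction 1; [apply spath_step|apply spath_cons]; auto. Qed.

Lemma spath_ball Q y a b n : spath Q a b n -> forall m, (d y a <= m)%nat ->
  spath (fun v => Q v /\ (d y v <= m + n)%nat) a b n.
Proof.
  induction 1 as [a b S|a c b n S Hc H IH]; intros m Hm.
  - apply spath_step; auto.
  - pose proof (dtri y a c). apply spath_cons; auto.
    + split; auto; lia.
    + apply (spath_mono (fun v => Q v /\ (d y v <= (m + d a c) + n)%nat)).
      * intros v [? ?]; split; auto; lia.
      * apply IH; lia.
Qed.

Lemma spath_last Q a b n : spath Q a b n ->
  exists e m, sstep e b /\ n = (m + d e b)%nat /\ ((e = a /\ m = 0%nat) \/ (Q e /\ spath Q a e m)).
Proof.
  induction 1 as [a b S|a c b n S Hc H (e & m & E1 & -> & E3)].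
  - exists a, 0%nat; auto.
  - exists e, (d a c + m)%nat; split; [auto|split; [lia|right]].
    destruct E3 as [[-> ->]|[He E]]; split; auto.
    + rewrite Nat.add_0_r; apply spath_step; auto.
    + apply spath_cons; auto.
Qed.

Definition val_lt B v := exists r, g v = Fin r /\ r < B.
Definition val_le B v := exists r, g v = Fin r /\ r <= B.

Lemma not_val_lt B v : ~ val_lt B v -> ER_le (Fin B) (g v).
Proof.
  intros N; destruct (g v) as [r|] eqn:E; simpl; auto.
  destruct (Rle_dec B r); auto. exfalso; apply N; exists r; split; auto; lra.
Qed.

Lemma gstar_fin s t c : gstar g (s, t) = Fin c ->
  exists a b, g s = Fin a /\ g t = Fin b /\ c = (a + b) / 2.
Proof.
  unfold gstar; simpl; destruct (g s) as [a|], (g t) as [b|]; simpl; try discriminate.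
  intros E; injection E; intros <-; exists a, b; repeat split; auto; field.
Qed.

Lemma gstar_lt s t c B : gstar g (s, t) = Fin c -> c < B ->
  exists a b, g s = Fin a /\ g t = Fin b /\ a + b < 2 * B.
Proof.
  intros E L; destruct (gstar_fin _ _ _ E) as (a & b & ? & ? & ->).
  exists a, b; repeat split; auto; lra.
Qed.

Lemma gstar_value s t a b : g s = Fin a -> g t = Fin b -> gstar g (s, t) = Fin ((a + b) / 2).
Proof. intros Es Et; unfold gstar; simpl; rewrite Es, Et; simpl; f_equal; field. Qed.

Variables (z : V) (B : R).
Hypothesis Hz : g z = Fin B.
Hypothesis Hsub : submodular (V * V) (Istar arc z) (incl_order arc) (gstar g).

Local Notation P := (Istar arc z).
Local Notation incl := (incl_order arc).
Local Notation cov := (cov_adj (V * V) P incl).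
Local Notation smeet := (smeet (V * V) P incl).

Let MS : modular_semilattice P incl (star_rank adj z) (z, z) :=
  Istar_modular_semilattice adj arc HG Hmod Hor z.
Let Istar_sub' := Istar_sub adj arc HG Hmod Hor z.
Let incl_iff' := incl_iff arc z.

Lemma star_smeet s t s' t' j m : P (s, t) -> P (s', t') -> lub_of arc s s' j -> glb_of arc t t' m ->
  smeet (s, t) (s', t') = (j, m).
Proof.
  intros H H' J M. apply (meet_unique P incl _ _ MS (s, t) (s', t')).
  - apply (smeet_spec P incl _ _ MS); auto.
  - apply (star_meet adj arc HG Hmod Hor); auto.
Qed.

(** Raising the lower end [s1] to its join with [a0] keeps both meets of [(s1, t1)] with the
    endpoints inside. As [(s1, t1)] is the join of these meets, nothing was raised. *)
Lemma Icov_lower_bound a t s b a0 s1 t1 : P (a, t) -> P (s, b) ->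
  Icov (V * V) P incl (a, t) (s, b) (s1, t1) -> le a0 a -> le a0 s -> le a0 s1.
Proof.
  intros Hp Hq I A1 A2.
  destruct (Icov_spec P incl _ _ MS _ _ _ Hp Hq I) as [J _].
  pose proof I as [Hu _].
  pose proof (smeet_spec P incl _ _ MS _ _ Hu Hp) as (M1 & M2 & M3 & _).
  pose proof (smeet_spec P incl _ _ MS _ _ Hu Hq) as (N1 & N2 & N3 & _).
  destruct J as (_ & _ & _ & J).
  destruct (smeet (s1, t1) (a, t)) as [x y], (smeet (s1, t1) (s, b)) as [x' y'].
  apply incl_iff' in M2, M3, N2, N3; auto; simpl in *.
  destruct M2, M3, N2, N3, Hp as (_ & P1 & P2). pose proof Hu as (_ & U1 & U2). simpl in *.
  assert (Za : le a0 z) by eauto using preceq_trans.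
  destruct (lub_exists adj arc HG Hmod Hor a0 s1 z Za U1) as [j (J1 & J2 & J3)].
  assert (Hw : P (j, t1)) by (apply (Istar_sub' s1 t1); auto using preceq_refl).
  assert (L : incl (s1, t1) (j, t1)).
  { apply J; auto; apply incl_iff'; auto; simpl; split; auto; apply J3; eauto using preceq_trans. }
  apply incl_iff' in L; auto; simpl in L; destruct L. eauto using preceq_trans.
Qed.

Lemma Icov_upper_bound a t s b b0 s1 t1 : P (a, t) -> P (s, b) ->
  Icov (V * V) P incl (a, t) (s, b) (s1, t1) -> le t b0 -> le b b0 -> le t1 b0.
Proof.
  intros Hp Hq I B1 B2.
  destruct (Icov_spec P incl _ _ MS _ _ _ Hp Hq I) as [J _].
  pose proof I as [Hu _].
  pose proof (smeet_spec P incl _ _ MS _ _ Hu Hp) as (M1 & M2 & M3 & _).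
  pose proof (smeet_spec P incl _ _ MS _ _ Hu Hq) as (N1 & N2 & N3 & _).
  destruct J as (_ & _ & _ & J).
  destruct (smeet (s1, t1) (a, t)) as [x y], (smeet (s1, t1) (s, b)) as [x' y'].
  apply incl_iff' in M2, M3, N2, N3; auto; simpl in *.
  destruct M2, M3, N2, N3, Hp as (_ & P1 & P2). pose proof Hu as (_ & U1 & U2). simpl in *.
  assert (Zb : le z b0) by eauto using preceq_trans.
  destruct (glb_exists adj arc HG Hmod Hor b0 t1 z Zb U2) as [m (G1 & G2 & G3)].
  assert (Hw : P (s1, m)) by (apply (Istar_sub' s1 t1); auto using preceq_refl).
  assert (L : incl (s1, t1) (s1, m)).
  { apply J; auto; apply incl_iff'; auto; simpl; split; auto; apply G3; eauto using preceq_trans. }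
  apply incl_iff' in L; auto; simpl in L; destruct L. eauto using preceq_trans.
Qed.

Lemma Icov_above p q u : P p -> P q -> Icov (V * V) P incl p q u -> incl (smeet p q) u.
Proof.
  intros Hp Hq I. destruct (Icov_spec P incl _ _ MS _ _ _ Hp Hq I) as [(_ & J & _) (M0 & M & _)].
  pose proof I as [Hu _]. pose proof (smeet_spec P incl _ _ MS _ _ Hu Hp) as (N & _).
  apply (ms_trans _ _ _ _ MS _ (smeet u p)); auto.
Qed.

(** Translates membership in the interval of the covering graph into [t] lying on a geodesic from
    [a] to [b], which keeps detours short. *)
Lemma star_gdist_upper x y : P (z, x) -> P (z, y) -> gdist cov (z, x) (z, y) = d x y.
Proof.
  intros Hx Hy. pose proof Hx as (_ & _ & Lx). pose proof Hy as (_ & _ & Ly). simpl in *.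
  destruct (glb_exists adj arc HG Hmod Hor x y z Lx Ly) as [m M].
  assert (Z : lub_of arc z z z) by (repeat split; auto using preceq_refl).
  pose proof (gdist_rank P incl _ _ MS _ _ _ Hx Hy
    (star_meet adj arc HG Hmod Hor z _ _ _ _ _ _ Hx Hy Z M)) as E.
  unfold star_rank in E; simpl in E. rewrite dist_refl in E.
  pose proof (glb_dist adj arc HG Hmod Hor _ _ _ M). destruct M as (M1 & M2 & M3).
  pose proof (ladd z m x (M3 _ Lx Ly) M1). pose proof (ladd z m y (M3 _ Lx Ly) M2).
  rewrite (dsym x m) in *. lia.
Qed.

Lemma star_gdist_lower x y : P (x, z) -> P (y, z) -> gdist cov (x, z) (y, z) = d x y.
Proof.
  intros Hx Hy. pose proof Hx as (_ & Lx & _). pose proof Hy as (_ & Ly & _). simpl in *.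
  destruct (lub_exists adj arc HG Hmod Hor x y z Lx Ly) as [j J].
  assert (Z : glb_of arc z z z) by (repeat split; auto using preceq_refl).
  pose proof (gdist_rank P incl _ _ MS _ _ _ Hx Hy
    (star_meet adj arc HG Hmod Hor z _ _ _ _ _ _ Hx Hy J Z)) as E.
  unfold star_rank in E; simpl in E. rewrite dist_refl in E.
  pose proof (lub_dist adj arc HG Hmod Hor _ _ _ J). destruct J as (J1 & J2 & J3).
  pose proof (ladd x j z J1 (J3 _ Lx Ly)). pose proof (ladd y j z J2 (J3 _ Lx Ly)).
  rewrite (dsym j y) in *. lia.
Qed.

Lemma upper_star a : sqsub arc z a -> P (z, a).
Proof. intros S; split; [|split]; simpl; auto using preceq_refl; apply S. Qed.
Lemma lower_star a : sqsub arc a z -> P (a, z).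
Proof. intros S; split; [|split]; simpl; auto using preceq_refl; apply S. Qed.

(** Any [u] between [(z, a)] and [(z, b)] has lower end [z] by [Icov_lower_bound]; since [g z = B],
    a value of [gstar] below [B] puts the upper end [t] below [B]. Both halves are shorter and again
    satisfy the strict inequality, now thanks to [t]. *)
Lemma reroute_upper n : forall a b ra rb, d a b = n -> sqsub arc z a -> sqsub arc z b ->
  g a = Fin ra -> g b = Fin rb -> ra <= B -> rb <= B -> ra + rb < 2 * B ->
  exists k, (k <= d a b)%nat /\ spath (val_lt B) a b k.
Proof.
  induction n as [n IH] using lt_wf_ind; intros a b ra rb En Sa Sb Ea Eb La Lb Lab.
  pose proof (upper_star a Sa) as Pa. pose proof (upper_star b Sb) as Pb.
  assert (U : forall v, sqsub arc z v -> forall w, le z w -> le w v -> sqsub arc w v).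
  { intros v Sv w W1 W2; apply (sub z v); auto using preceq_refl. }
  destruct (classic (le a b)) as [C|C].
  { exists (d a b); split; auto. apply spath_step; left; apply U; auto; apply Sa. }
  destruct (classic (le b a)) as [C'|C'].
  { exists (d a b); split; auto. apply spath_step; right; apply U; auto; apply Sb. }
  destruct (glb_exists adj arc HG Hmod Hor a b z (proj1 Sa) (proj1 Sb)) as [m M].
  assert (Z : lub_of arc z z z) by (repeat split; auto using preceq_refl).
  pose proof (star_smeet _ _ _ _ _ _ Pa Pb Z M) as Em.
  pose proof (glb_dist adj arc HG Hmod Hor _ _ _ M) as Dm.
  destruct (classic (val_lt B m)) as [Q|Q].
  { destruct M as (M1 & M2 & M3). assert (le z m) by (apply M3; [apply Sa|apply Sb]).
    exists (d a m + d m b)%nat; split; [lia|].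
    apply spath_cons; [right; apply U; auto|auto|apply spath_step; left; apply U; auto]. }
  destruct (semilattice_descent P incl _ _ MS (gstar g) (z, a) (z, b)
    ((B + ra) / 2) ((B + rb) / 2) B)
    as ([s t] & c & I & Na & Nb & Eu & Lc); auto using gstar_value; try lra.
  - intros L; apply incl_iff' in L; auto; apply C, L.
  - intros L; apply incl_iff' in L; auto; apply C', L.
  - rewrite Em. apply not_val_lt in Q. unfold gstar; simpl; rewrite Hz.
    destruct (g m); simpl in *; auto. lra.
  - pose proof I as [Pu G]. assert (s = z) as ->.
    { apply lantisym; [apply Pu|]. apply (Icov_lower_bound z a z b z s t); auto using preceq_refl. }
    destruct (gstar_lt _ _ _ _ Eu Lc) as (r & rt & Er & Et & Lt).
    rewrite Hz in Er; injection Er; intros <-.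
    unfold ginterval in G. rewrite !star_gdist_upper in G; auto.
    assert (d a t <> 0%nat /\ d t b <> 0%nat) as [? ?].
    { split; intros E; apply (dist_zero adj HG) in E; congruence. }
    assert (sqsub arc z t) by apply Pu.
    destruct (IH (d a t) ltac:(lia) a t ra rt) as (k1 & K1 & S1); auto; try lra.
    destruct (IH (d t b) ltac:(lia) t b rt rb) as (k2 & K2 & S2); auto; try lra.
    exists (k1 + k2)%nat; split; [lia|]. apply spath_app with t; auto.
    exists rt; split; auto; lra.
Qed.

Lemma reroute_lower n : forall a b ra rb, d a b = n -> sqsub arc a z -> sqsub arc b z ->
  g a = Fin ra -> g b = Fin rb -> ra <= B -> rb <= B -> ra + rb < 2 * B ->
  exists k, (k <= d a b)%nat /\ spath (val_lt B) a b k.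
Proof.
  induction n as [n IH] using lt_wf_ind; intros a b ra rb En Sa Sb Ea Eb La Lb Lab.
  pose proof (lower_star a Sa) as Pa. pose proof (lower_star b Sb) as Pb.
  assert (U : forall v, sqsub arc v z -> forall w, le w z -> le v w -> sqsub arc v w).
  { intros v Sv w W1 W2; apply (sub v z); auto using preceq_refl. }
  destruct (classic (le a b)) as [C|C].
  { exists (d a b); split; auto. apply spath_step; left; apply U; auto; apply Sb. }
  destruct (classic (le b a)) as [C'|C'].
  { exists (d a b); split; auto. apply spath_step; right; apply U; auto; apply Sa. }
  destruct (lub_exists adj arc HG Hmod Hor a b z (proj1 Sa) (proj1 Sb)) as [m M].
  assert (Z : glb_of arc z z z) by (repeat split; auto using preceq_refl).
  pose proof (star_smeet _ _ _ _ _ _ Pa Pb M Z) as Em.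
  pose proof (lub_dist adj arc HG Hmod Hor _ _ _ M) as Dm.
  destruct (classic (val_lt B m)) as [Q|Q].
  { destruct M as (M1 & M2 & M3). assert (le m z) by (apply M3; [apply Sa|apply Sb]).
    exists (d a m + d m b)%nat; split; [lia|].
    apply spath_cons; [left; apply U; auto|auto|apply spath_step; right; apply U; auto]. }
  destruct (semilattice_descent P incl _ _ MS (gstar g) (a, z) (b, z)
    ((ra + B) / 2) ((rb + B) / 2) B)
    as ([s t] & c & I & Na & Nb & Eu & Lc); auto using gstar_value; try lra.
  - intros L; apply incl_iff' in L; auto; apply C', L.
  - intros L; apply incl_iff' in L; auto; apply C, L.
  - rewrite Em. apply not_val_lt in Q. unfold gstar; simpl; rewrite Hz.
    destruct (g m); simpl in *; auto. lra.
  - pose proof I as [Pu G]. assert (t = z) as ->.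
    { apply lantisym; [|apply Pu]. apply (Icov_upper_bound a z b z z s t); auto using preceq_refl. }
    destruct (gstar_lt _ _ _ _ Eu Lc) as (rt & r & Et & Er & Lt).
    rewrite Hz in Er; injection Er; intros <-.
    unfold ginterval in G. rewrite !star_gdist_lower in G; auto.
    assert (d a s <> 0%nat /\ d s b <> 0%nat) as [? ?].
    { split; intros E; apply (dist_zero adj HG) in E; congruence. }
    assert (sqsub arc s z) by apply Pu.
    destruct (IH (d a s) ltac:(lia) a s ra rt) as (k1 & K1 & S1); auto; try lra.
    destruct (IH (d s b) ltac:(lia) s b rt rb) as (k2 & K2 & S2); auto; try lra.
    exists (k1 + k2)%nat; split; [lia|]. apply spath_app with s; auto.
    exists rt; split; auto; lra.
Qed.

(** The case of interest is [t = s = z], with [a] below and [b] above [z]. The general form, with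
    [s] and [t] moving away from [z] towards [a] and [b], is what the recursion preserves: the
    averages stay at most [B], not both equal to it, and [d a s + d t b] decreases. *)
Lemma reroute_through n : forall a t s b ra rt rs rb, (d a s + d t b)%nat = n ->
  P (a, t) -> P (s, b) -> le a s -> le t b ->
  g a = Fin ra -> g t = Fin rt -> g s = Fin rs -> g b = Fin rb -> ra <= B -> rb <= B ->
  (ra + rt) / 2 <= B -> (rs + rb) / 2 <= B -> ra + rt + rs + rb < 4 * B ->
  exists k, (k <= d a z + d z b)%nat /\ spath (val_lt B) a b k.
Proof.
  induction n as [n IH] using lt_wf_ind.
  intros a t s b ra rt rs rb En Hp Hq Las Ltb Ea Et Es Eb La Lb Lp Lq Lpq.
  pose proof Hp as (Sp & P1 & P2). pose proof Hq as (Sq & Q1 & Q2). simpl in *.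
  assert (direct : sstep a b -> exists k, (k <= d a z + d z b)%nat /\ spath (val_lt B) a b k).
  { intros S; exists (d a b); split; [apply dtri|apply spath_step; auto]. }
  (* Once [s] reaches [a] or [t] reaches [b], one of the two intervals is the one from [a] to [b],
     so a single step suffices. *)
  destruct (classic (s = a)) as [->|Ns]; [apply direct; left; auto|].
  destruct (classic (t = b)) as [->|Nt]; [apply direct; left; auto|].
  pose proof (ladd a s z Las Q1). pose proof (ladd z t b P2 Ltb).
  assert (Asub : forall w, le a w -> le w z -> sstep a w).
  { intros w W1 W2; left; apply (sub a t); eauto using preceq_refl, preceq_trans. }
  assert (Bsub : forall w, le z w -> le w b -> sstep w b).
  { intros w W1 W2; left; apply (sub s b); eauto using preceq_refl, preceq_trans. }
  destruct (Rlt_dec rs B) as [Ls|Ls].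
  { exists (d a s + d s b)%nat; split; [pose proof (dtri s z b); lia|].
    apply spath_cons; [auto|exists rs; auto|apply spath_step; left; auto]. }
  destruct (Rlt_dec rt B) as [Lt|Lt].
  { exists (d a t + d t b)%nat; split; [pose proof (dtri a z t); lia|].
    apply spath_cons; [left; auto|exists rt; auto|apply spath_step; auto]. }
  assert (Em : smeet (a, t) (s, b) = (s, t)).
  { apply star_smeet; auto; repeat split; auto using preceq_refl. }
  destruct (semilattice_descent P incl _ _ MS (gstar g) (a, t) (s, b)
    ((ra + rt) / 2) ((rs + rb) / 2) B)
    as ([s1 t1] & c & I & Np & Nq & Eu & Lc); auto using gstar_value; try lra.
  - intros L; apply incl_iff' in L; auto; simpl in L. apply Ns, lantisym; tauto.
  - intros L; apply incl_iff' in L; auto; simpl in L. apply Nt, lantisym; tauto.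
  - rewrite Em, (gstar_value s t rs rt); auto; simpl; lra.
  - destruct (gstar_lt _ _ _ _ Eu Lc) as (r1 & r2 & E1 & E2 & L12).
    pose proof (Icov_above _ _ _ Hp Hq I) as A. pose proof I as [Hu _].
    rewrite Em in A; apply incl_iff' in A; simpl in A;
      [|apply (Istar_sub' s b); auto using preceq_refl].
    destruct A as [A1 A2].
    pose proof (Icov_lower_bound _ _ _ _ a _ _ Hp Hq I (preceq_refl _ _) Las) as A3.
    pose proof (Icov_upper_bound _ _ _ _ b _ _ Hp Hq I Ltb (preceq_refl _ _)) as A4.
    pose proof Hu as (_ & U1 & U2); simpl in *.
    pose proof (ladd a s1 s A3 A1). pose proof (ladd t t1 b A2 A4).
    (* The average of [r1] and [r2] is below [B], so one of them is. A good [s1] is reached from [a]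
       in one step and replaces it; otherwise [t1] is good and replaces [b]. *)
    destruct (Rlt_dec r1 B) as [L1|L1].
    + assert (N : (d s1 s + d t1 b < n)%nat).
      { destruct (Nat.eq_dec (d a s1) 0) as [Z1|Z1]; [|lia].
        destruct (Nat.eq_dec (d t t1) 0) as [Z2|Z2]; [|lia].
        apply (dist_zero adj HG) in Z1, Z2; subst; congruence. }
      destruct (IH _ N s1 t1 s b r1 r2 rs rb) as (k & K & S); auto; try lra.
      pose proof (ladd a s1 z A3 U1).
      exists (d a s1 + k)%nat; split; [lia|]. apply spath_cons; auto. exists r1; auto.
    + assert (N : (d a s1 + d t t1 < n)%nat).
      { destruct (Nat.eq_dec (d s1 s) 0) as [Z1|Z1]; [|lia].
        destruct (Nat.eq_dec (d t1 b) 0) as [Z2|Z2]; [|lia].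
        apply (dist_zero adj HG) in Z1, Z2; subst; congruence. }
      destruct (IH _ N a t s1 t1 ra rt r1 r2) as (k & K & S); auto; try lra.
      pose proof (ladd z t1 b U2 A4).
      exists (k + d t1 b)%nat; split; [lia|].
      apply spath_app with t1; auto; [exists r2; split; auto; lra|apply spath_step; auto].
Qed.

Lemma reroute a b ra rb : sstep a z -> sstep z b -> g a = Fin ra -> g b = Fin rb ->
  ra <= B -> rb <= B -> ra + rb < 2 * B ->
  exists k, (k <= d a z + d z b)%nat /\ spath (val_lt B) a b k.
Proof.
  intros [Sa|Sa] [Sb|Sb] Ea Eb La Lb Lab.
  - apply (reroute_through _ a z z b ra B B rb eq_refl); auto using lower_star, upper_star; try lra;
      [apply Sa|apply Sb].
  - destruct (reroute_lower _ a b ra rb eq_refl) as (k & K & S); auto.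
    exists k; split; auto. pose proof (dtri a z b); lia.
  - destruct (reroute_upper _ a b ra rb eq_refl) as (k & K & S); auto.
    exists k; split; auto. pose proof (dtri a z b); lia.
  - destruct (reroute_through _ b z z a rb B B ra eq_refl) as (k & K & S);
      auto using lower_star, upper_star; try lra; [apply Sb|apply Sa|].
    exists k; split; [rewrite (dsym a z), (dsym z b); lia|apply spath_rev; auto].
Qed.

End Reroute.

(** * Lowering a path *)

Lemma isolated_from_list (r : R) (L : list R) : exists eps, 0 < eps /\
  forall a, In a L -> r - eps <= a <= r + eps -> a = r.
Proof.
  induction L as [|x L (eps & He & H)]; [exists 1; split; [lra|intros a []]|].
  destruct (Req_dec x r) as [->|N].
  - exists eps; split; auto. intros a [<-|I]; auto.
  - pose proof (Rmin_l eps (Rabs (x - r) / 2)). pose proof (Rmin_r eps (Rabs (x - r) / 2)).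
    assert (0 < Rabs (x - r)) by (apply Rabs_pos_lt; lra).
    exists (Rmin eps (Rabs (x - r) / 2)); split; [apply Rmin_glb_lt; lra|].
    intros a [<-|I] B; [|apply H; auto; lra].
    assert (Rabs (x - r) <= Rabs (x - r) / 2) by (apply Rabs_le; lra). lra.
Qed.

Lemma finite_list_discrete (L : list R) : exists eps, 0 < eps /\
  forall a b, In a L -> In b L -> a - eps <= b <= a + eps -> b = a.
Proof.
  induction L as [|x L (e1 & He1 & H1)]; [exists 1; split; [lra|intros a b []]|].
  destruct (isolated_from_list x L) as (e2 & He2 & H2).
  pose proof (Rmin_l e1 e2). pose proof (Rmin_r e1 e2).
  exists (Rmin e1 e2); split; [apply Rmin_glb_lt; auto|].
  intros a b [<-|Ia] [<-|Ib] B; auto.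
  - apply H2; auto; lra.
  - symmetry; apply H2; auto; lra.
  - apply H1; auto; lra.
Qed.

Section Criterion.
Context {V : Type} (adj arc : V -> V -> Prop) (g : V -> ER).
Hypothesis HG : simple_connected_graph adj.
Hypothesis Hmod : modular_graph adj.
Hypothesis Hor : admissible_orientation adj arc.

Local Notation d := (gdist adj).
Local Notation sstep := (sstep arc).
Local Notation spath := (spath adj arc).
Local Notation val_lt := (val_lt g).
Local Notation val_le := (val_le g).

Lemma ball_finite : locally_finite adj -> forall y n,
  exists l, forall v, (d y v <= n)%nat -> In v l.
Proof.
  intros LF y n; induction n as [|n [l Hl]].
  - exists (y :: nil); intros v H. left; apply (dist_zero adj HG); lia.
  - assert (exists l', forall v w, In v l -> adj v w -> In w l') as [l' Hl'].
    { clear Hl; induction l as [|v l [l' IH]]; [exists nil; intros v w []|].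
      destruct (LF v) as [lv Hv]. exists (lv ++ l').
      intros u w [<-|I] A; apply in_or_app; eauto. }
    exists (l ++ l'); intros v H; apply in_or_app.
    destruct (classic (v = y)) as [->|N]; [left; apply Hl; rewrite dist_refl; lia|].
    destruct (dist_step adj HG v y N) as (w & A & E). rewrite (dist_sym adj HG v y) in E.
    right; apply (Hl' w); [|apply HG; auto].
    apply Hl; rewrite (dist_sym adj HG); lia.
Qed.

Lemma values_isolated : locally_finite adj \/ discrete_image g -> forall y N,
  exists eps, 0 < eps /\ forall v w a b, (d y v <= N)%nat -> (d y w <= N)%nat ->
    g v = Fin a -> g w = Fin b -> a - eps <= b <= a + eps -> b = a.
Proof.
  intros [LF|(eps & He & H)] y N; [|exists eps; split; auto; intros; eapply H; eauto].
  destruct (ball_finite LF y N) as [l Hl].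
  (* The default 0 at infinite values only adds an entry to a finite list. *)
  destruct (finite_list_discrete (map (fun v => match g v with Fin r => r | PInf => 0 end) l))
    as (eps & He & H).
  exists eps; split; auto. intros v w a b Hv Hw Ea Eb; apply H; apply in_map_iff;
    [exists v; rewrite Ea; auto|exists w; rewrite Eb; auto].
Qed.

Hypothesis Hsub : forall z, submodular (V * V) (Istar arc z) (incl_order arc) (gstar g).

(** If [g c = M], the vertex [e] before [c] has value below [M], so [reroute] at [c] replaces the
    two steps from [e] to [b]. The bound on [a] is needed when [e] is [a] itself. *)
Lemma spath_extend M a c b n : spath (val_lt M) a c n -> val_lt M a -> val_le M c ->
  sstep c b -> val_le M b -> exists k, (k <= n + d c b)%nat /\ spath (val_lt M) a b k.
Proof.
  intros H (ra & Ea & La) (rc & Ec & Lc) S (rb & Eb & Lb).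
  destruct (Rlt_dec rc M) as [L|L].
  { exists (n + d c b)%nat; split; auto.
    apply (spath_app adj arc _ a c b); auto; [exists rc; auto|apply spath_step; auto]. }
  assert (rc = M) as -> by lra.
  destruct (spath_last adj arc _ _ _ _ H) as (e & m & S1 & -> & E).
  assert (val_lt M e) as (re & Ee & Le) by (destruct E as [[-> _]|[? _]]; auto; exists ra; auto).
  destruct (reroute adj arc g HG Hmod Hor c M Ec (Hsub c) e b re rb) as (k & K & P); auto; try lra.
  destruct E as [[-> ->]|[He E]].
  - exists k; split; auto; lia.
  - exists (m + k)%nat; split; [lia|]. apply (spath_app adj arc _ a e b); auto.
Qed.

(** A single sweep from the low end removes every vertex of value [M]: the interior of the processed
    part stays below [M], so each further vertex meets the strictness that [reroute] demands. *)
Lemma spath_extend_path M c b n : spath (val_le M) c b n -> val_le M b -> val_le M c ->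
  forall a m, val_lt M a -> spath (val_lt M) a c m ->
  exists k, (k <= m + n)%nat /\ spath (val_lt M) a b k.
Proof.
  induction 1 as [c b S|c e b n S He H IH]; intros Hb Hc a m Ha P.
  - apply (spath_extend M a c b m); auto.
  - destruct (spath_extend M a c e m) as (k & K & P'); auto.
    destruct (IH Hb He a k) as (k' & K' & P''); auto.
    exists k'; split; auto; lia.
Qed.

Lemma spath_lower M y x n : spath (val_le M) y x n -> val_lt M y -> val_le M x ->
  exists k, (k <= n)%nat /\ spath (val_lt M) y x k.
Proof.
  intros H Hy Hx; destruct H as [y x S|y c x n S Hc H].
  - exists (d y x); split; auto. apply spath_step; auto.
  - apply (spath_extend_path M c x n); auto. apply spath_step; auto.
Qed.

Variables (x y : V) (rx ry eps : R) (N : nat).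
Hypothesis Ex : g x = Fin rx.
Hypothesis Ey : g y = Fin ry.
Hypothesis Lxy : ry < rx.
Hypothesis Heps : 0 < eps.
Hypothesis isolated : forall v w a b, (d y v <= N)%nat -> (d y w <= N)%nat ->
  g v = Fin a -> g w = Fin b -> a - eps <= b <= a + eps -> b = a.
Hypothesis local_min : forall v, sstep v x -> ER_le (Fin rx) (g v).

Lemma spath_in_ball Q n : spath Q y x n -> (n <= N)%nat ->
  spath (fun v => Q v /\ (d y v <= N)%nat) y x n.
Proof.
  intros P Hn. apply (spath_mono adj arc (fun v => Q v /\ (d y v <= 0 + n)%nat)).
  - intros v [? ?]; split; auto; lia.
  - apply spath_ball; auto. rewrite dist_refl; auto.
Qed.

(** Induction on the number [k] of layers of height [eps] above [rx]; within the ball at most one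
    value of [g] falls in each layer. At [k = 0] a last lowering makes the vertex before [x] violate
    [local_min]. *)
Lemma no_path k : forall n, (n <= N)%nat -> ~ spath (val_le (rx + INR k * eps)) y x n.
Proof.
  assert (Hy : forall M, rx <= M -> val_lt M y) by (intros M HM; exists ry; split; auto; lra).
  assert (Hx : forall M, rx <= M -> val_le M x) by (intros M HM; exists rx; split; auto; lra).
  induction k as [|k IH]; intros n Hn P.
  - simpl in P; rewrite Rmult_0_l, Rplus_0_r in P.
    destruct (spath_lower rx y x n P) as (k & _ & P'); [apply Hy|apply Hx|]; try lra.
    destruct (spath_last adj arc _ _ _ _ P') as (e & m & S & _ & E).
    assert (val_lt rx e) as (re & Ee & Le).
    { destruct E as [[-> _]|[? _]]; auto. apply Hy; lra. }
    specialize (local_min e S); rewrite Ee in local_min; simpl in local_min; lra.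
  - rewrite S_INR in P. pose proof (pos_INR k). set (C := rx + INR k * eps) in *.
    assert (HC : rx <= C) by (unfold C; nra).
    replace (rx + (INR k + 1) * eps) with (C + eps) in P by (unfold C; ring).
    apply spath_in_ball in P; auto.
    (* If the value [r] occurs in the top layer, the whole path is at most [r]; lowering at level
       [r] leaves interior values below [r], hence at most [C] by isolation. *)
    destruct (classic (exists v r, (d y v <= N)%nat /\ g v = Fin r /\ C < r <= C + eps))
      as [(v & r & Hv & Ev & Lv)|F].
    + assert (P1 : spath (val_le r) y x n).
      { eapply spath_mono; [|exact P]. intros w [(rw & Ew & Lw) Hw]. exists rw; split; auto.
        destruct (Rle_dec rw C); [lra|].
        rewrite (isolated v w r rw); auto; lra. }
      destruct (spath_lower r y x n P1) as (k' & K' & P2); [apply Hy|apply Hx|]; try lra.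
      apply (IH k'); [lia|]. apply spath_in_ball in P2; [|lia].
      eapply spath_mono; [|exact P2]. intros w [(rw & Ew & Lw) Hw]. exists rw; split; auto.
      destruct (Rle_dec rw C); auto.
      assert (rw = r) by (apply (isolated v w); auto; lra). lra.
    + apply (IH n Hn). eapply spath_mono; [|exact P].
      intros w [(rw & Ew & Lw) Hw]. exists rw; split; auto.
      destruct (Rle_dec rw C); auto. exfalso; apply F; exists w, rw; repeat split; auto; lra.
Qed.

End Criterion.

Lemma spath_bounded {V : Type} (adj arc : V -> V -> Prop) (g : V -> ER) a b n :
  spath adj arc (in_dom g) a b n -> exists M, spath adj arc (val_le g M) a b n.
Proof.
  induction 1 as [a b S|a c b n S [r Hr] H [M IH]]; [exists 0; apply spath_step; auto|].
  exists (Rmax r M); apply spath_cons; auto.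
  - exists r; split; auto; apply Rmax_l.
  - eapply spath_mono; [|exact IH]. intros v (rv & Ev & Lv); exists rv; split; auto.
    pose proof (Rmax_r r M); lra.
Qed.

Lemma delta'_path {V : Type} (adj arc : V -> V -> Prop) (S : V -> Prop) a b :
  clos_refl_trans V (fun a b => S a /\ S b /\ (sqsub arc a b \/ sqsub arc b a)) a b ->
  a <> b -> exists n, spath adj arc S a b n.
Proof.
  intros H; apply clos_rt_rt1n in H; induction H as [a|a c b (Sa & Sc & H) K IH]; [tauto|].
  intros _. destruct (classic (c = b)) as [<-|N].
  - exists (gdist adj a c); apply spath_step; auto.
  - destruct (IH N) as [n P]. exists (gdist adj a c + n)%nat; apply spath_cons; auto.
Qed.

Theorem theorem4p6 (V : Type) (adj arc : V -> V -> Prop) (g : V -> ER)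
  (HG : simple_connected_graph adj)
  (Hmod : modular_graph adj)
  (Hor : admissible_orientation adj arc)
  (HL : L_convex arc g)
  (Hfin : locally_finite adj \/ discrete_image g)
  (x : V) (Hx : in_dom g x) :
  minimizer_over g (fun _ => True) x <->
  minimizer_over g (fun y => sqsub arc x y \/ sqsub arc y x) x.
Proof.
  split; [intros H y _; apply H; auto|].
  intros H y _. apply NNPP; intros F. destruct Hx as [rx Ex], HL as [Hconn Hsub].
  destruct (g y) as [ry|] eqn:Ey; [|rewrite Ex in F; apply F; exact I].
  rewrite Ex in F; simpl in F.
  destruct (delta'_path adj arc (in_dom g) y x) as [N P].
  { apply Hconn; [exists ry; auto|exists rx; auto|intros ->; rewrite Ex in Ey; injection Ey; lra]. }
  { intros ->; rewrite Ex in Ey; injection Ey; lra. }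
  destruct (spath_bounded adj arc g y x N P) as [M PM].
  destruct (values_isolated adj g HG Hfin y N) as (eps & He & Hiso).
  (* Enough layers to reach the maximum [M] of the initial path. *)
  destruct (INR_unbounded ((M - rx) / eps)) as [k Hk].
  apply (no_path adj arc g HG Hmod Hor Hsub x y rx ry eps N) with k N; auto; try lra.
  - intros v Sv; rewrite <- Ex; apply H. destruct Sv; auto.
  - eapply spath_mono; [|exact PM]. intros v (r & Er & Lr); exists r; split; auto.
    apply Rmult_gt_compat_r with (r := eps) in Hk; auto.
    replace ((M - rx) / eps * eps) with (M - rx) in Hk by (field; lra). lra.
Qed.
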